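(* Let $k\in\{1,2,3\}$ and $n\ge 64k^6$. Then for every simple graph $G$ (not necessarily planar) of order $n$ which does not contain $k$ pairwise edge-disjoint cycles, $\rho(G)\le \rho(K_1\nabla H)$, with equality if and only if $G\cong K_1\nabla H$, where $H$ is the disjoint union of the friendship graph $F_{k-1}$ and $n-2k$ isolated vertices.
   Context: $\rho(G)$ denotes the spectral radius of the adjacency matrix of $G$. For vertex-disjoint graphs $G_1,G_2$, the join $G_1\nabla G_2$ is obtained from their disjoint union by joining every vertex of $G_1$ to every vertex of $G_2$. The friendship graph $F_m$ ($m\ge1$) consists of $m$ triangles sharing exactly one common vertex; $F_0$ is a single isolated vertex. *)

(* Defs.v *)
From HB Require Import structures.
From mathcomp Require Import all_boot all_order all_algebra all_fingroup.
From mathcomp Require Import classical_sets reals.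
From mathcomp Require Import complex.

Set Implicit Arguments.
Unset Strict Implicit.
Unset Printing Implicit Defensive.

Import Order.TTheory GRing.Theory Num.Theory.
Local Open Scope ring_scope.

Record sgraph (n : nat) := SGraph {
  adj : rel 'I_n;
  adj_sym : symmetric adj;
  adj_irr : irreflexive adj }.

Definition adjmx (R : realType) (n : nat) (G : sgraph n) : 'M[R]_n :=
  \matrix_(i, j) (adj G i j)%:R.

(* Spectral radius of a real square matrix: the supremum of the moduli of its
   (complex) eigenvalues; the spectrum is finite, so this is a maximum. *)
Definition spectral_radius (R : realType) (n : nat) (A : 'M[R]_n) : R :=
  sup [set Normc.normc z | z in [set z : R[i] |
          eigenvalue (map_mx (real_complex R) A) z]]%classic.

Definition rho (R : realType) (n : nat) (G : sgraph n) : R :=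
  spectral_radius (adjmx R G).

Definition isomorphic (n : nat) (G H : sgraph n) : Prop :=
  exists f : {perm 'I_n}, forall x y, adj G x y = adj H (f x) (f y).

Definition is_graph_cycle (n : nat) (G : sgraph n) (c : seq 'I_n) : bool :=
  [&& (3 <= size c)%N, uniq c & path.cycle (adj G) c].

Definition cycle_edges (n : nat) (c : seq 'I_n) : {set {set 'I_n}} :=
  [set [set x; next c x] | x in c].

Definition has_k_edge_disjoint_cycles (n : nat) (G : sgraph n) (k : nat) : Prop :=
  exists cs : 'I_k -> seq 'I_n,
    (forall i, is_graph_cycle G (cs i)) /\
    (forall i j, i != j -> [disjoint cycle_edges (cs i) & cycle_edges (cs j)]).

(* Vertex 0 is the K_1 joined to everything; vertex 1 is the centre of the
   friendship graph F_{k-1}, whose triangles are {1, 2i, 2i+1} for 1 <= i <= k-1;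
   vertices 2k, ..., n-1 are the n-2k isolated vertices of H.
   (For k = 1, F_0 is the single vertex 1.) *)
Definition KH_edge (k : nat) (x y : nat) : bool :=
  [|| x == 0%N,
      (x == 1%N) && (2 <= y < 2 * k)%N
   | [&& (2 <= x < 2 * k)%N, (2 <= y < 2 * k)%N & x./2 == y./2]].

Definition KH_adj (n k : nat) : rel 'I_n :=
  fun x y => (x != y) && (KH_edge k x y || KH_edge k y x).

Arguments KH_adj : clear implicits.

Lemma KH_adj_sym (n k : nat) : symmetric (KH_adj n k).
Proof. by move=> x y; rewrite /KH_adj eq_sym orbC. Qed.

Lemma KH_adj_irr (n k : nat) : irreflexive (KH_adj n k).
Proof. by move=> x; rewrite /KH_adj eqxx. Qed.

Definition KH (n k : nat) : sgraph n :=
  SGraph (@KH_adj_sym n k) (@KH_adj_irr n k).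
Arguments KH : clear implicits.

(* Main.v *)
(* Let [x] be a nonnegative nonzero vector with [rho G * x <= A x] entrywise (the
   moduli of an eigenvector), scaled to have maximal entry 1 at [u], and suppose that
   [rho G] is at least [lam], the eigenvalue of [KH n k] with a positive eigenvector.
   A graph without [k] edge-disjoint cycles has fewer than [k * n] edges, two of its
   vertices have at most [2 * k - 1] common neighbours, and few edges lie inside a
   neighbourhood.  Counting walks of length 2 from [u] then gives
   [n - 1 <= rho G ^+ 2 <= n - 1 - D + o(1) * (D + 1)] where [D] is the number of
   non-neighbours of [u], hence [D = 0].  The edges of [G - u] are now restricted by
   explicit forbidden configurations: either [G] is a subgraph of [KH n k], where
   testing against the positive eigenvector of [KH n k] settles everything, or [k = 3]
   and [G - u] has maximum degree at most 3; in that case its degrees satisfy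
   [sum d <= 12] and [sum d ^ 2 <= 30], against 12 and 32 for the friendship graph
   [F_2], and walks of length 3 from [u] give [rho G < lam]. *)
Require Import Defs.
From HB Require Import structures.
From mathcomp Require Import all_boot all_order all_algebra all_fingroup.
From mathcomp Require Import classical_sets reals.
From mathcomp Require Import complex.
From mathcomp Require Import zify ring lra.
(* [classical_sets] shadows the lemmas on finite sets. *)
From mathcomp Require Import fintype finset.
Import Order.TTheory GRing.Theory Num.Theory.

Set Implicit Arguments.
Unset Strict Implicit.
Unset Printing Implicit Defensive.

(** * Edge-disjoint cycles *)

Definition same_edge (T : eqType) (e f : T * T) : bool :=
  (e == f) || (e == (f.2, f.1)).

Definition cyc_pairs (T : Type) (c : seq T) : seq (T * T) := zip c (rot 1 c).

(** Computable form of the disjointness of [cycle_edges]: on explicit lists of vertices it unfolds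
    to equalities between vertices, so concrete cycles are compared by rewriting. *)
Definition avoid_edges (T : eqType) (c c' : seq T) : bool :=
  all (fun e => all (fun f => ~~ same_edge e f) (cyc_pairs c')) (cyc_pairs c).

Lemma same_edge_set2 (T : finType) (x y a b : T) :
  [set x; y] = [set a; b] -> same_edge (x, y) (a, b).
Proof.
move=> E; rewrite /same_edge !xpair_eqE /=.
have : x \in [set a; b] by rewrite -E set21.
have : y \in [set a; b] by rewrite -E set22.
have : a \in [set x; y] by rewrite E set21.
have : b \in [set x; y] by rewrite E set22.
rewrite !inE (eq_sym b) (eq_sym b y) (eq_sym a) (eq_sym a y).
by do 4![case: (_ == _) => //=].
Qed.

Lemma mem_cyc_pairs (T : eqType) (c : seq T) x :
  x \in c -> (x, next c x) \in cyc_pairs c.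
Proof.
case: c => // y p xc; rewrite next_nth xc /cyc_pairs rot1_cons.
have ix : (index x (y :: p) < size (y :: p))%N by rewrite index_mem.
have -> : (x, nth y p (index x (y :: p))) =
    nth (x, y) (zip (y :: p) (rcons p y)) (index x (y :: p)).
  rewrite nth_zip ?size_rcons// nth_rcons_default; congr pair.
  by rewrite nth_index.
by apply: mem_nth; rewrite size_zip size_rcons /= minnn.
Qed.

Lemma avoid_edges_disjoint (n : nat) (c c' : seq 'I_n) :
  avoid_edges c c' -> [disjoint cycle_edges c & cycle_edges c'].
Proof.
move=> /allP H; rewrite disjoints_subset; apply/subsetP => e /imsetP[x xc ->].
rewrite inE; apply/negP => /imsetP[y yc' E].
have /allP /(_ _ (mem_cyc_pairs yc')) := H _ (mem_cyc_pairs xc).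
by rewrite (same_edge_set2 E).
Qed.

Lemma has_cycles_seq (n : nat) (G : sgraph n) (L : seq (seq 'I_n)) :
  all (is_graph_cycle G) L -> pairwise (@avoid_edges _) L ->
  has_k_edge_disjoint_cycles G (size L).
Proof.
move=> /allP Lc /(pairwiseP [::]) Ld; exists (fun i => nth [::] L i); split.
  by move=> i; apply: Lc; rewrite mem_nth.
move=> i j; rewrite -val_eqE neq_ltn => /orP[] ij.
  by apply: avoid_edges_disjoint; apply: Ld; rewrite ?inE /=.
by rewrite disjoint_sym; apply: avoid_edges_disjoint; apply: Ld; rewrite ?inE /=.
Qed.

Lemma cyclic_edge (n : nat) (G : sgraph n) (c : seq 'I_n) x :
  is_graph_cycle G c -> x \in c -> adj G x (next c x).
Proof. by case/and3P => _ _ H xc; apply: next_cycle. Qed.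

Definition disj_pairs (T : eqType) (e f : T * T) : bool :=
  [&& e.1 != f.1, e.1 != f.2, e.2 != f.1 & e.2 != f.2].

Lemma disjoint_pairs_of_seq (T : eqType) (s : seq T) k :
  uniq s -> (2 * k <= size s)%N ->
  exists L : seq (T * T),
    [/\ size L = k, pairwise (@disj_pairs T) L
      & forall e, e \in L -> [&& e.1 \in s, e.2 \in s & e.1 != e.2]].
Proof.
elim: k s => [|k IH] s us sz; first by exists [::].
case: s us sz => [|a [|b s]] /=; try by lia.
rewrite inE negb_or => /and3P[/andP[ab ias] ibs us] sz.
have [|L [sL pL mL]] := IH s us; first by lia.
exists ((a, b) :: L); split => /=; first by rewrite sL.
  rewrite pL andbT; apply/allP => e /mL /and3P[e1 e2 _].
  rewrite /disj_pairs /=; apply/and4P; split;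
  by [apply: contraNneq ias => -> | apply: contraNneq ibs => ->].
move=> e; rewrite inE => /orP[/eqP-> /=|/mL /and3P[e1 e2 e3]].
  by rewrite !inE !eqxx orbT.
by rewrite !inE e1 e2 e3 !orbT.
Qed.

Definition nbr (n : nat) (G : sgraph n) (x : 'I_n) : {set 'I_n} :=
  [set y | adj G x y].

Definition codeg (n : nat) (G : sgraph n) (x y : 'I_n) : nat :=
  #|nbr G x :&: nbr G y|.

Lemma adj_neq (n : nat) (G : sgraph n) x y : adj G x y -> x != y.
Proof. by apply: contraTneq => ->; rewrite adj_irr. Qed.

Lemma neqE (T : eqType) (x y : T) :
  x != y -> (x == y = false) * (y == x = false).
Proof. by move=> H; rewrite (eq_sym y) (negPf H). Qed.

(** From [2 * k] common neighbours, [k] disjoint pairs [e] give the four-cycles [x, e.1, y, e.2].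
    Each edge joins [x] or [y] to a vertex of its own pair, so two of these cycles share no edge. *)
Lemma codeg_bound (n : nat) (G : sgraph n) k x y :
  (0 < k)%N -> ~ has_k_edge_disjoint_cycles G k -> x != y ->
  (codeg G x y <= 2 * k - 1)%N.
Proof.
move=> k0 nG xy; rewrite leqNgt; apply/negP => H; apply: nG.
have [|L [<- pL mL]] := @disjoint_pairs_of_seq _ _ k (enum_uniq (nbr G x :&: nbr G y)).
  by rewrite -cardE -/(codeg G x y); lia.
rewrite -(size_map (fun e => [:: x; e.1; y; e.2])).
apply: has_cycles_seq.
  apply/allP => z /mapP[e /mL + ->]; rewrite !mem_enum !inE.
  case/and3P => /andP[x1 y1] /andP[x2 y2] e12.
  rewrite /is_graph_cycle /= !inE !negb_or xy e12 x1 y2.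
  by rewrite (adj_sym _ e.1) y1 (adj_sym _ e.2) x2 ?(adj_neq x1) ?(adj_neq x2)
    ?(adj_neq y2) eq_sym (adj_neq y1).
rewrite pairwise_map; apply: sub_in_pairwise pL; last exact/allP/mL.
move=> e f /=.
move=> /and3P[]; rewrite !mem_enum !inE => /andP[x1 y1] /andP[x2 y2] _.
move=> /and3P[]; rewrite !mem_enum !inE => /andP[x1' y1'] /andP[x2' y2'] _.
case/and4P => /negPf a1 /negPf a2 /negPf a3 /negPf a4.
rewrite /avoid_edges /= /same_edge !xpair_eqE /= a1 a2 a3 a4.
have E z t : adj G z t -> (z == t = false) * (t == z = false).
  by move/adj_neq/neqE.
by rewrite !(neqE xy, E _ _ x1, E _ _ x2, E _ _ y1, E _ _ y2, E _ _ x1',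
  E _ _ x2', E _ _ y1', E _ _ y2') ?andbF.
Qed.

(** * Dense graphs contain many edge-disjoint cycles *)

Lemma card_nbrI (n : nat) (G : sgraph n) x (S : {set 'I_n}) :
  #|nbr G x :&: S| = \sum_(y in S) adj G x y.
Proof.
rewrite -sum1_card big_mkcond [RHS]big_mkcond; apply: eq_bigr => y _.
by rewrite !inE andbC; case: (y \in S); case: (adj G x y).
Qed.

(** The path grows at its head [x] until all neighbours of [x] in [S] lie on it; one of them other
    than the second vertex then closes a cycle. *)
Lemma path_cycle_exists (n : nat) (G : sgraph n) (S : {set 'I_n}) :
  (forall x, x \in S -> 2 <= #|nbr G x :&: S|)%N ->
  forall x p, uniq (x :: p) -> path (adj G) x p -> all [in S] (x :: p) ->
  exists c, is_graph_cycle G c.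
Proof.
move=> degS x p; move: {2}(n - size p)%N (leqnn (n - size p)) => m.
elim: m x p => [|m IH] x p sz uxp pp aS.
  (* Here [x :: p] would have more than [n] distinct vertices. *)
  by have := max_card (mem (x :: p)); rewrite (card_uniqP uxp) card_ord /= => H;
    rewrite leqn0 subn_eq0 leqNgt H in sz.
have xS : x \in S by case/andP: aS.
have [sub|/subsetPn[y]] := boolP (nbr G x :&: S \subset [set z in p]); last first.
  rewrite !inE => /andP[xy yS] yp.
  apply: (IH y (x :: p)) => //=.
  - by rewrite subnS; case: (n - size p)%N sz.
  - by rewrite inE negb_or eq_sym (adj_neq xy) yp.
  - by rewrite adj_sym xy.
  - by rewrite yS.
case: p {sz IH} uxp pp aS sub => [|z p] uxp pp aS sub.
  have := degS _ xS; suff -> : nbr G x :&: S = set0 by rewrite cards0.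
  by apply/eqP; rewrite -subset0; apply/subsetP => y /(subsetP sub); rewrite !inE.
have [y] : exists y, y \in (nbr G x :&: S) :\ z.
  apply/set0Pn; rewrite -card_gt0; have := degS _ xS.
  rewrite (cardsD1 z (nbr G x :&: S)).
  by case: (z \in _) => /=; rewrite ?add1n ?add0n ?ltnS // => /ltnW.
rewrite in_setD1 => /andP[yz yN]; have := subsetP sub _ yN.
move: yN; rewrite !inE (negPf yz) /= => /andP[xy _] yp.
case/splitPr: yp uxp pp {aS sub} => p1 p2 uxp pp.
exists (x :: z :: rcons p1 y); apply/and3P; split => //.
- by rewrite /= size_rcons.
- move: uxp; rewrite -cat_rcons -!cat_cons cat_uniq.
  by case/and3P.
- move: pp; rewrite /= -cat_rcons cat_path => /and3P[xz zy _] /=.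
  by rewrite xz rcons_path zy last_rcons adj_sym xy.
Qed.

Lemma min_degree_cycle (n : nat) (G : sgraph n) (S : {set 'I_n}) :
  (0 < #|S|)%N -> (forall x, x \in S -> 2 <= #|nbr G x :&: S|)%N ->
  exists c, is_graph_cycle G c.
Proof.
move=> /card_gt0P[x xS] degS; apply: (path_cycle_exists degS (x := x) (p := [::])) => //=.
by rewrite xS.
Qed.

(** The double sum counts each edge twice, so [S] spans at least [#|S|] edges. Removing a vertex
    with at most one neighbour in [S] preserves this; if there is no such vertex, [min_degree_cycle]
    applies. *)
Lemma dense_cycle (n : nat) (G : sgraph n) (S : {set 'I_n}) :
  (0 < #|S|)%N -> (2 * #|S| <= \sum_(x in S) \sum_(y in S) adj G x y)%N ->
  exists c, is_graph_cycle G c.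
Proof.
move: {2}#|S| (leqnn #|S|) => m; elim: m S => [|m IH] S Sm S0; first by lia.
move=> dS; have [/forall_inP/(min_degree_cycle S0)//|] :=
  boolP [forall x in S, (2 <= #|nbr G x :&: S|)%N].
rewrite negb_forall_in => /exists_inP[x xS]; rewrite -ltnNge ltnS card_nbrI => dx.
have cS : #|S| = #|S :\ x|.+1 by rewrite (cardsD1 x) xS.
have dS' : (\sum_(y in S) \sum_(z in S) adj G y z <=
    \sum_(y in S :\ x) \sum_(z in S :\ x) adj G y z + 2)%N.
  have E (F : 'I_n -> nat) : \sum_(y in S) F y = F x + \sum_(y in S :\ x) F y.
    by rewrite (bigD1 x) //=; congr addn; apply: eq_bigl => y; rewrite !inE andbC.
  rewrite E; under [X in (_ + X <= _)%N]eq_bigr do rewrite E.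
  rewrite big_split /=; have := dx; rewrite E adj_irr /= add0n => dx'.
  have -> : \sum_(i in S :\ x) (adj G i x : nat) = \sum_(i in S :\ x) adj G x i.
    by apply: eq_bigr => y _; rewrite adj_sym.
  by rewrite addnA addnC leq_add2l (leq_add dx' dx').
apply: (IH (S :\ x)); first by lia.
  rewrite lt0n; apply/eqP => S'0; move: dS'; rewrite (cards0_eq S'0) big_set0.
  have S1 : S = [set x] by apply/eqP; rewrite eq_sym eqEcard sub1set xS cS S'0 cards1.
  by move: dS; rewrite S1 !big_set1 adj_irr cards1.
by lia.
Qed.

Definition del_adj (n : nat) (G : sgraph n) (c : seq 'I_n) : rel 'I_n :=
  fun x y => adj G x y && ([set x; y] \notin cycle_edges c).

Lemma del_adj_sym (n : nat) (G : sgraph n) (c : seq 'I_n) :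
  symmetric (del_adj G c).
Proof. by move=> x y; rewrite /del_adj adj_sym setUC. Qed.

Lemma del_adj_irr (n : nat) (G : sgraph n) (c : seq 'I_n) :
  irreflexive (del_adj G c).
Proof. by move=> x; rewrite /del_adj adj_irr. Qed.

Definition del (n : nat) (G : sgraph n) (c : seq 'I_n) : sgraph n :=
  SGraph (@del_adj_sym n G c) (@del_adj_irr n G c).

Lemma del_cycle (n : nat) (G : sgraph n) (c c' : seq 'I_n) :
  is_graph_cycle (del G c) c' ->
  is_graph_cycle G c' /\ [disjoint cycle_edges c & cycle_edges c'].
Proof.
move=> Hc'; split.
  case/and3P: Hc' => H1 H2 H3; apply/and3P; split => //.
  by apply: sub_cycle H3 => x y /andP[].
rewrite disjoint_sym disjoints_subset; apply/subsetP => _ /imsetP[x xc' ->].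
by rewrite inE; case/andP: (cyclic_edge Hc' xc').
Qed.

(** The only neighbours of [x] that can be lost are its successor and its predecessor on [c]. *)
Lemma del_degree (n : nat) (G : sgraph n) (c : seq 'I_n) x : uniq c ->
  (#|nbr G x| <= #|nbr (del G c) x| + 2)%N.
Proof.
move=> uc; have c2 : (#|[set next c x; prev c x]| <= 2)%N.
  by rewrite cards2; case: (_ == _).
apply: leq_trans (leq_add (leqnn _) c2); apply: leq_trans (leq_card_setU _ _).
apply: subset_leq_card; apply/subsetP => y; rewrite !inE /= /del_adj => ->.
case: imsetP => //= -[z zc /same_edge_set2]; rewrite /same_edge !xpair_eqE /=.
move=> /orP[] /andP[/eqP-> /eqP->]; rewrite ?eqxx ?prev_next ?eqxx ?orbT //.
Qed.

(** Greedy removal: deleting the edges of one cycle lowers the degree sum by at most [2 * n], so the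
    hypothesis for [k.+1] leaves the one for [k] in the remaining graph, whose cycles avoid the
    deleted edges. *)
Lemma dense_cycles (n : nat) (G : sgraph n) k :
  (0 < n)%N -> (2 * k * n <= \sum_x #|nbr G x|)%N ->
  has_k_edge_disjoint_cycles G k.
Proof.
move=> n0; elim: k G => [|k IH] G dG.
  by exists (fun=> [::]); split; case.
have [||c Hc] := @dense_cycle n G setT.
- by rewrite cardsT card_ord.
- rewrite cardsT card_ord; apply: leq_trans (_ : (_ <= 2 * k.+1 * n)%N) _; first by lia.
  apply: leq_trans dG _; rewrite [leqRHS](eq_bigl xpredT) => [|x]; last by rewrite inE.
  by apply: leq_sum => x _; rewrite -card_nbrI setIT.
have [|cs [cs1 cs2]] := IH (del G c).
  have : (\sum_x #|nbr G x| <= \sum_x (#|nbr (del G c) x| + 2))%N.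
    by apply: leq_sum => x _; apply: del_degree; case/and3P: Hc.
  rewrite big_split /= sum_nat_const card_ord => /(leq_trans dG).
  by rewrite (_ : 2 * k.+1 * n = 2 * k * n + n * 2)%N ?leq_add2r; last lia.
exists (fun i => if unlift ord0 i is Some j then cs j else c); split.
  by move=> i; case: unliftP => [j|] _ //; case: (del_cycle (cs1 j)).
move=> i j; case: unliftP => [i'|] ->; case: unliftP => [j'|] -> // ij.
- by apply: cs2; apply: contraNneq ij => ->.
- by rewrite disjoint_sym; case: (del_cycle (cs1 i')).
- by case: (del_cycle (cs1 j')).
Qed.

(** A matching is extended as long as some edge avoids it; when none does, its endpoints cover all
    edges. *)
Lemma matching_or_cover (T : finType) (e : rel T) k :
  exists L : seq (T * T), [/\ all (fun f => e f.1 f.2) L, pairwise (@disj_pairs T) L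
    & size L = k \/ ((size L < k)%N /\
      forall x y, e x y -> (x \in unzip1 L ++ unzip2 L) || (y \in unzip1 L ++ unzip2 L))].
Proof.
elim: k => [|k [L [aL pL [sL|[sL cL]]]]]; first by exists [::]; split => //; left.
  have [/existsP[[x y] /= /and3P[xy xL yL]]|] := boolP [exists f : T * T,
    [&& e f.1 f.2, f.1 \notin unzip1 L ++ unzip2 L & f.2 \notin unzip1 L ++ unzip2 L]].
    exists ((x, y) :: L); split => /=; [by rewrite xy | | by left; rewrite sL].
    rewrite pL andbT; apply/allP => f fL; move: xL yL.
    rewrite !mem_cat !negb_or => /andP[x1 x2] /andP[y1 y2].
    have f1 : f.1 \in unzip1 L by apply: map_f.
    have f2 : f.2 \in unzip2 L by apply: map_f.
    apply/and4P; split => /=; by [apply: contraNneq x1 => -> | apply: contraNneq x2 => ->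
                           | apply: contraNneq y1 => -> | apply: contraNneq y2 => ->].
  rewrite negb_exists => /forallP H; exists L; split => //; right; split; first by lia.
  move=> x y xy; have := H (x, y); rewrite /= xy /= negb_and !negbK; by [].
by exists L; split => //; right; split => //; lia.
Qed.

(** * Forbidden configurations around a dominating vertex *)

(** Each matching edge inside the neighbourhood of [u] spans a triangle with [u], and these
    triangles meet only in [u]. *)
Lemma hub_matching (n : nat) (G : sgraph n) k u (L : seq ('I_n * 'I_n)) :
  ~ has_k_edge_disjoint_cycles G k ->
  (forall e, e \in L -> [&& adj G e.1 e.2, adj G u e.1 & adj G u e.2]) ->
  pairwise (@disj_pairs _) L -> size L <> k.
Proof.
move=> nG aL pL sL; apply: nG; rewrite -sL -(size_map (fun e => [:: u; e.1; e.2])).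
apply: has_cycles_seq.
  apply/allP => z /mapP[e /aL/and3P[e12 u1 u2] ->].
  by rewrite /is_graph_cycle /= !inE !(neqE (adj_neq e12), neqE (adj_neq u1), neqE (adj_neq u2))
    u1 e12 adj_sym u2.
rewrite pairwise_map; apply: sub_in_pairwise pL; last exact/allP/aL.
move=> e f /and3P[e12 /adj_neq u1 /adj_neq u2] /and3P[f12 /adj_neq v1 /adj_neq v2].
move=> /and4P[a1 a2 a3 a4].
rewrite /avoid_edges /= /same_edge !xpair_eqE /=.
by rewrite !(neqE u1, neqE u2, neqE v1, neqE v2, neqE a1, neqE a2, neqE a3, neqE a4) ?andbF.
Qed.

Ltac split_hyps :=
  repeat match goal with
  | H : is_true (_ && _) |- _ => let A := fresh in let B := fresh in case/andP: H => A B
  end.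

(** Each distinctness or adjacency hypothesis serves as a rewrite rule and is then cleared, so that
    the loop terminates. *)
Ltac explicit_cycles L :=
  apply: (@has_cycles_seq _ _ L);
  rewrite /is_graph_cycle /avoid_edges /= /same_edge ?xpair_eqE /= ?inE;
  repeat match goal with
  | H : is_true (_ != _) |- _ => rewrite ?(neqE H); clear H
  | H : is_true (adj ?G ?x ?y) |- _ => rewrite ?(neqE (adj_neq H)) ?(adj_sym G y x) ?H; clear H
  end; by rewrite /= ?andbF.

Section Hub.
Variables (n : nat) (G : sgraph n) (u : 'I_n).
Hypothesis hub : forall x, x != u -> adj G u x.

Ltac config := rewrite /= !inE !negb_or => D; split_hyps;
  repeat match goal with H : is_true (u != ?x) |- _ =>
    lazymatch goal with
    | _ : is_true (adj G u x) |- _ => fail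
    | _ => have ? : adj G u x by apply: hub; rewrite eq_sym
    end end;
  move=> *.

Lemma hub_star3 v a b c : uniq [:: u; v; a; b; c] ->
  adj G v a -> adj G v b -> adj G v c -> has_k_edge_disjoint_cycles G 2.
Proof. by config; explicit_cycles [:: [:: u; v; a]; [:: u; b; v; c]]. Qed.

Lemma hub_star5 v a b c d e : uniq [:: u; v; a; b; c; d; e] ->
  adj G v a -> adj G v b -> adj G v c -> adj G v d -> adj G v e ->
  has_k_edge_disjoint_cycles G 3.
Proof.
by config; explicit_cycles [:: [:: u; v; a]; [:: u; b; v; c]; [:: u; d; v; e]].
Qed.

Lemma hub_star_edge v a b c p q : uniq [:: u; v; a; b; c; p; q] ->
  adj G v a -> adj G v b -> adj G v c -> adj G p q ->
  has_k_edge_disjoint_cycles G 3.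
Proof.
by config; explicit_cycles [:: [:: u; v; a]; [:: u; b; v; c]; [:: u; p; q]].
Qed.

Lemma hub_star_path v a b c d : uniq [:: u; v; a; b; c; d] ->
  adj G v a -> adj G v b -> adj G v c -> adj G v d -> adj G a b -> adj G b c ->
  has_k_edge_disjoint_cycles G 3.
Proof.
by config; explicit_cycles [:: [:: u; v; d]; [:: u; a; b]; [:: v; b; c]].
Qed.

Lemma hub_triangle x y z p q : uniq [:: u; x; y; z; p; q] ->
  adj G x y -> adj G y z -> adj G z x -> adj G x p -> adj G y q ->
  has_k_edge_disjoint_cycles G 3.
Proof.
by config; explicit_cycles [:: [:: x; y; z]; [:: u; x; p]; [:: u; y; q]].
Qed.

Lemma hub_square x y z w p q : uniq [:: u; x; y; z; w; p; q] ->
  adj G x y -> adj G y z -> adj G z w -> adj G w x -> adj G x p -> adj G w q ->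
  has_k_edge_disjoint_cycles G 3.
Proof.
by config; explicit_cycles [:: [:: x; y; z; w]; [:: u; x; p]; [:: u; w; q]].
Qed.

(** With [u] this is a K5, whose ten edges split into two triangles and a four-cycle. *)
Lemma hub_K4 v a b c : uniq [:: u; v; a; b; c] ->
  adj G v a -> adj G v b -> adj G v c -> adj G a b -> adj G b c -> adj G c a ->
  has_k_edge_disjoint_cycles G 3.
Proof.
by config; explicit_cycles [:: [:: u; v; a]; [:: u; b; c]; [:: v; b; a; c]].
Qed.

End Hub.

(** * Degree sums and vertex covers *)

(** A vertex of [S :\: C] has all its neighbours of [S] in [C], so the degrees outside [C] count the
    edges between [C] and [S :\: C]. Adding the degrees inside [C] turns this count into a second
    copy of the sum over [C]. *)
Lemma cover_degree_sum (n : nat) (G : sgraph n) (S C : {set 'I_n}) :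
  C \subset S ->
  (forall x y, x \in S -> y \in S -> adj G x y -> (x \in C) || (y \in C)) ->
  (\sum_(x in S) #|nbr G x :&: S| + \sum_(x in C) #|nbr G x :&: C| =
   2 * \sum_(x in C) #|nbr G x :&: S|)%N.
Proof.
move=> CS cov; set A := \sum_(x in C) #|nbr G x :&: S|.
have split x : #|nbr G x :&: S| = (#|nbr G x :&: C| + #|nbr G x :&: (S :\: C)|)%N.
  rewrite -{1}(setID S C) setIUr (setIidPr CS) cardsU; suff -> :
    nbr G x :&: C :&: (nbr G x :&: (S :\: C)) = set0 by rewrite cards0 subn0.
  by apply/setP => y; rewrite !inE; case: (y \in C); rewrite ?andbF.
have -> : \sum_(x in S) #|nbr G x :&: S| =
    (A + \sum_(x in S :\: C) #|nbr G x :&: C|)%N.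
  rewrite (bigID (fun x => x \in C)) /=; congr addn.
    by apply: eq_bigl => x; rewrite andbC; case: (boolP (x \in C)) => //= /(subsetP CS).
  apply: eq_big => x; first by rewrite !inE andbC.
  move=> /andP[xS xC]; congr #|pred_of_set _|; apply/setP => y; rewrite !inE.
  case xy: (adj G x y) => //=; apply/idP/idP => [yS|/(subsetP CS)//].
  by have := cov _ _ xS yS xy; rewrite (negPf xC).
have -> : \sum_(x in S :\: C) #|nbr G x :&: C| =
    \sum_(x in C) #|nbr G x :&: (S :\: C)|.
  rewrite (eq_bigr _ (fun x _ => card_nbrI G x C)) exchange_big /=.
  apply: eq_bigr => y _; rewrite card_nbrI; apply: eq_bigr => x _.
  by rewrite adj_sym.
rewrite -addnA [X in (A + X)%N]addnC -big_split /=.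
by rewrite -(eq_bigr _ (fun x _ => split x)) mul2n addnn.
Qed.

(** The neighbourhood of [u] has no matching of [k] edges, by [hub_matching], hence it has a vertex
    cover of at most [2 * (k - 1)] vertices. Each of them has at most [2 * k - 1] neighbours there,
    by [codeg_bound]. *)
Lemma nbhd_edges_bound (n : nat) (G : sgraph n) k u :
  (0 < k)%N -> ~ has_k_edge_disjoint_cycles G k ->
  (\sum_(x in nbr G u) #|nbr G x :&: nbr G u| <= 4 * (k - 1) * (2 * k - 1))%N.
Proof.
move=> k0 nG.
have [L [aL pL cL]] := matching_or_cover
  (fun x y => [&& adj G x y, x \in nbr G u & y \in nbr G u]) k.
have aL' e : e \in L -> [&& adj G e.1 e.2, adj G u e.1 & adj G u e.2].
  by move/(allP aL); rewrite !inE.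
have [sL cov] : (size L < k)%N /\ forall x y,
    [&& adj G x y, x \in nbr G u & y \in nbr G u] ->
    (x \in unzip1 L ++ unzip2 L) || (y \in unzip1 L ++ unzip2 L).
  by case: cL => // sL; case: (hub_matching nG aL' pL sL).
pose C := [set x in unzip1 L ++ unzip2 L].
have CS : C \subset nbr G u.
  apply/subsetP => x; rewrite !inE mem_cat => /orP[] /mapP[e /aL'/and3P[_ e1 e2] ->] //.
have cC : (#|C| <= 2 * (k - 1))%N.
  rewrite cardsE; apply: leq_trans (card_size _) _.
  by rewrite size_cat !size_map; lia.
have cov' x y : x \in nbr G u -> y \in nbr G u -> adj G x y -> (x \in C) || (y \in C).
  move=> xu yu xy; rewrite /C [x \in _]in_set [y \in [set _ in _]]in_set.
  by apply: cov; rewrite xy xu.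
apply: leq_trans (leq_addr (\sum_(x in C) #|nbr G x :&: C|) _) _.
rewrite (cover_degree_sum CS cov').
rewrite (_ : 4 * (k - 1) * (2 * k - 1) = 2 * (2 * (k - 1) * (2 * k - 1)))%N; last by lia.
rewrite leq_mul2l /=; apply: leq_trans (_ : \sum_(x in C) (2 * k - 1) <= _)%N.
  apply: leq_sum => x xC; apply: codeg_bound => //.
  by have /(subsetP CS) := xC; rewrite inE => /adj_neq; rewrite eq_sym.
by rewrite sum_nat_const leq_mul2r cC orbT.
Qed.

Lemma subseq_of_card (T : finType) (A : {set T}) m : (m <= #|A|)%N ->
  exists s : seq T, [/\ size s = m, uniq s & forall x, x \in s -> x \in A].
Proof.
move=> mA; exists (take m (enum A)); split.
- by rewrite size_takel // -cardE.
- exact/take_uniq/enum_uniq.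
- by move=> x /mem_take; rewrite mem_enum.
Qed.

Lemma card3_elements (T : finType) (A : {set T}) : (3 <= #|A|)%N ->
  exists a b c, [/\ a \in A, b \in A, c \in A, a != b & (a != c) && (b != c)].
Proof.
case/subseq_of_card => -[|a [|b [|c [|? ?]]]] /= [] // _.
rewrite !inE negb_or andbT => /andP[/andP[ab ac] bc] sA.
by exists a, b, c; rewrite !sA ?inE ?eqxx ?orbT // ab ac bc.
Qed.

Ltac solve_uniq := rewrite /= ?inE;
  repeat match goal with
  | H : is_true (_ != _) |- _ => rewrite ?(neqE H); clear H
  | H : is_true (adj _ _ _) |- _ => rewrite ?(neqE (adj_neq H)); clear H
  end; done.

(** * Degree sums of [G - u] for maximum degree at most 3 *)

Section HubTriple.
Variables (n : nat) (G : sgraph n) (u : 'I_n).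
Hypothesis hub : forall x, x != u -> adj G u x.
Hypothesis noG : ~ has_k_edge_disjoint_cycles G 3.

Let S : {set 'I_n} := [set~ u].
Let d x := #|nbr G x :&: S|.

Lemma star_cover v a b c p q : v \in S -> p \in S -> q \in S ->
  a \in nbr G v :&: S -> b \in nbr G v :&: S -> c \in nbr G v :&: S ->
  a != b -> a != c -> b != c -> adj G p q -> p != v -> q != v ->
  [|| p == a, p == b, p == c, q == a, q == b | q == c].
Proof.
rewrite !inE => vS pS qS /andP[va aS] /andP[vb bS] /andP[vc cS] ab ac bc pq pv qv.
apply/negPn/negP; rewrite !negb_or => /and5P[pa pb pc qa /andP[qb qc]].
apply: noG; apply: (hub_star_edge hub (v := v) (a := a) (b := b) (c := c)) (pq) => //.
by solve_uniq.
Qed.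

(** When [v] has exactly three neighbours in [S], the triple met by each edge off [v] in
    [star_cover] is the whole neighbourhood. *)
Lemma star3_cover v x y : v \in S -> d v = 3 -> x \in S -> y \in S ->
  adj G x y -> x != v -> y != v ->
  (x \in nbr G v :&: S) || (y \in nbr G v :&: S).
Proof.
move=> vS dv xS yS xy xv yv.
have [|a [b [c [aN bN cN ab /andP[ac bc]]]]] := @card3_elements _ (nbr G v :&: S).
  by rewrite -/(d v) dv.
have := star_cover vS xS yS aN bN cN ab ac bc xy xv yv.
by do ![case/orP]=> /eqP->; rewrite ?aN ?bN ?cN ?orbT.
Qed.

(* An edge avoiding both [v] and [a] would create a triangle or a square with pendant
   edges at two adjacent vertices, or a K4. *)
Lemma adjacent_deg3_cover v a x y : v \in S -> a \in S -> adj G v a ->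
  d v = 3 -> d a = 3 -> x \in S -> y \in S -> adj G x y ->
  [|| x == v, x == a, y == v | y == a].
Proof.
move=> vS aS va dv da xS yS xy; apply/negPn/negP; rewrite !negb_or.
case/and4P => xv xa yv ya.
have av : adj G a v by rewrite adj_sym.
have third w w' z : adj G w w' -> w' \in S -> d w = 3 -> z \in S ->
    exists c, [/\ adj G w c, c != u, c != w' & c != z].
  move=> ww' w'S dw zS.
  have [c] : exists c, c \in (nbr G w :&: S) :\: [set w'; z].
    apply/set0Pn; rewrite -card_gt0.
    have := cardsID [set w'; z] (nbr G w :&: S); rewrite -/(d w) dw.
    have : (#|nbr G w :&: S :&: [set w'; z]| <= 2)%N.
      by apply: leq_trans (subset_leq_card (subsetIr _ _)) _; rewrite cards2; case: (_ == _).
    by case: #|_ :\: _| => // H1 H2; rewrite addn0 in H2; rewrite H2 in H1.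
  rewrite !inE negb_or => /andP[/andP[cw' cz] /andP[wc cu]].
  by exists c.
(* Here [v], [a], [w] form a triangle with the pendant edge [w z]. A third neighbour of [v] or of
   [a] other than [z] gives a second pendant edge; otherwise both are adjacent to [z] and a K4
   appears. *)
have common w z : w \in S -> z \in S -> adj G w z -> w != v -> w != a -> z != v -> z != a ->
    adj G v w -> adj G a w -> False.
  move=> wS zS wz wv wa zv za vw aw.
  have [b' [vb' b'u b'a b'w]] := third _ _ _ va aS dv wS.
  have [p' [ap' p'u p'v p'w]] := third _ _ _ av vS da wS.
  move: vS aS wS zS; rewrite !inE => vu au wu zu.
  have wv' : adj G w v by rewrite adj_sym.
  have wa' : adj G w a by rewrite adj_sym.
  have [b'z|b'z] := eqVneq b' z; last first.
    apply: noG; apply: (hub_triangle hub (x := w) (y := v) (z := a)) (wz) (vb') => //.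
    by solve_uniq.
  have [p'z|p'z] := eqVneq p' z; last first.
    apply: noG; apply: (hub_triangle hub (x := w) (y := a) (z := v)) (wz) (ap') => //.
    by solve_uniq.
  subst b' p'; have zw : adj G z w by rewrite adj_sym.
  have za' : adj G z a by rewrite adj_sym.
  apply: noG; apply: (hub_K4 hub (v := v) (a := a) (b := w) (c := z)) => //.
  by solve_uniq.
(* Here [v], [w], [z], [a] form a square. Third neighbours [c] of [v] and [q] of [a] are its
   pendants; if they coincide, [v], [a], [c] form a triangle with pendants [w] and [z]. *)
have opposite w z : w \in S -> z \in S -> adj G w z -> w != v -> w != a -> z != v -> z != a ->
    adj G v w -> adj G a z -> False.
  move=> wS zS wz wv wa zv za vw az.
  have [aw|aw] := boolP (adj G a w); first exact: (common w z).
  have [vz|vz] := boolP (adj G v z).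
    by apply: (common z w) => //; rewrite adj_sym.
  have [c [vc cu ca cw]] := third _ _ _ va aS dv wS.
  have [q [aq qu qv qz]] := third _ _ _ av vS da zS.
  move: vS aS wS zS; rewrite !inE => vu au wu zu.
  have cz : c != z by apply: contraNneq vz => <-.
  have qw : q != w by apply: contraNneq aw => <-.
  have [cq|cq] := eqVneq c q.
    subst q; apply: noG.
    apply: (hub_triangle hub (x := v) (y := a) (z := c)) (vw) (az) => //; last by rewrite adj_sym.
    by solve_uniq.
  apply: noG; apply: (hub_square hub (x := v) (y := w) (z := z) (w := a)) (vc) (aq) => //.
    by solve_uniq.
  by rewrite adj_sym.
have yx : adj G y x by rewrite adj_sym.
have := star3_cover vS dv xS yS xy xv yv.
have := star3_cover aS da xS yS xy xa ya.
rewrite !in_setI xS yS !andbT !inE => /orP[] a1 /orP[] v1.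
- exact: (common x y).
- exact: (opposite y x).
- exact: (opposite x y).
- exact: (common y x).
Qed.

(** Three cases, each with a small vertex cover. If all degrees are at most 2, the endpoints of a
    maximal matching cover. If two vertices of degree 3 are adjacent, they cover. Otherwise the
    three neighbours of a vertex of degree 3 cover, and their degrees are at most 2. *)
Lemma max_degree3_bounds : (forall v, v \in S -> d v <= 3)%N ->
  (\sum_(x in S) d x <= 12 /\ \sum_(x in S) d x ^ 2 <= 30)%N.
Proof.
move=> d3.
have sq_bound m : (forall x, x \in S -> d x <= m)%N ->
    (\sum_(x in S) d x ^ 2 <= m * \sum_(x in S) d x)%N.
  move=> dm; rewrite big_distrr /=; apply: leq_sum => x xS.
  by rewrite expnS expn1 leq_mul2r dm ?orbT.
have sub_sum (C : {set 'I_n}) m : C \subset S -> (forall x, x \in C -> d x <= m)%N ->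
    (\sum_(x in C) d x <= #|C| * m)%N.
  by move=> CS Cm; rewrite -sum_nat_const; apply: leq_sum.
have [/existsP[v /andP[vS /eqP dv]]|] := boolP [exists v, (v \in S) && (d v == 3)]; last first.
  rewrite negb_exists => /forallP d2'.
  have d2 x : x \in S -> (d x <= 2)%N.
    move=> xS; have := d3 _ xS; have := d2' x; rewrite xS /=.
    by rewrite leq_eqVlt => /negPf->.
  suff H : (\sum_(x in S) d x <= 12)%N.
    split=> //; apply: leq_trans (sq_bound 2 d2) _.
    by apply: leq_trans (leq_mul (leqnn 2) H) _.
  have [L [aL pL cL]] := matching_or_cover (fun x y => [&& adj G x y, x \in S & y \in S]) 3.
  have aL' e : e \in L -> [&& adj G e.1 e.2, adj G u e.1 & adj G u e.2].
    by move/(allP aL); rewrite !inE => /and3P[-> ? ?]; rewrite !hub.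
  have [sL cov] : (size L < 3)%N /\ forall x y, [&& adj G x y, x \in S & y \in S] ->
      (x \in unzip1 L ++ unzip2 L) || (y \in unzip1 L ++ unzip2 L).
    by case: cL => // sL; case: (hub_matching noG aL' pL sL).
  pose C := [set x in unzip1 L ++ unzip2 L].
  have inC x : (x \in C) = (x \in unzip1 L ++ unzip2 L) by rewrite in_set.
  have CS : C \subset S.
    apply/subsetP => x; rewrite inC mem_cat => /orP[] /mapP[e /(allP aL)/and3P[_ e1 e2] ->] //.
  have cC : (#|C| <= 4)%N.
    rewrite cardsE; apply: leq_trans (card_size _) _.
    by rewrite size_cat !size_map; lia.
  have cov' x y : x \in S -> y \in S -> adj G x y -> (x \in C) || (y \in C).
    by move=> xu yu xy; rewrite !inC; apply: cov; rewrite xy xu.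
  (* Every vertex of [C] has its matching partner in [C]; with [cover_degree_sum] this bounds the
     degree sum by [4 * #|C| - #|C| <= 12]. *)
  have inner : (#|C| <= \sum_(x in C) #|nbr G x :&: C|)%N.
    rewrite -sum1_card; apply: leq_sum => x; rewrite inC mem_cat card_gt0 => xL.
    apply/set0Pn; case/orP: xL => /mapP[e eL ->]; case/and3P: (allP aL _ eL) => e12 _ _.
      by exists e.2; rewrite in_setI inC mem_cat (map_f snd) // orbT andbT inE.
    by exists e.1; rewrite in_setI inC mem_cat (map_f fst) //= andbT inE adj_sym.
  have := cover_degree_sum CS cov'.
  have := sub_sum C 2 CS (fun x xC => d2 x (subsetP CS _ xC)).
  rewrite -/(\sum_(x in S) d x) -/(\sum_(x in C) d x).
  move: (\sum_(x in S) d x) (\sum_(x in C) d x) (\sum_(x in C) _) #|C| cC inner => s c i m.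
  by lia.
pose C := nbr G v :&: S.
have CS : C \subset S by apply: subsetIr.
have cC : #|C| = 3 by exact: dv.
have [/existsP[a /andP[aC /eqP da]]|] := boolP [exists a, (a \in C) && (d a == 3)].
  have aS : a \in S by apply: (subsetP CS).
  have va : adj G v a by move: aC; rewrite !inE => /andP[].
  have vaS : [set v; a] \subset S by rewrite subUset !sub1set vS.
  have cov2 x y : x \in S -> y \in S -> adj G x y -> (x \in [set v; a]) || (y \in [set v; a]).
    move=> xS yS xy; have := adjacent_deg3_cover vS aS va dv da xS yS xy.
    by rewrite !inE -!orbA.
  have i1 : (0 < #|nbr G v :&: [set v; a]|)%N.
    by rewrite card_gt0; apply/set0Pn; exists a; rewrite !inE va eqxx orbT.
  have i2 : (0 < #|nbr G a :&: [set v; a]|)%N.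
    by rewrite card_gt0; apply/set0Pn; exists v; rewrite !inE adj_sym va eqxx.
  (* Two degrees 3, doubled, minus the edge [v a] counted twice: [2 * 6 - 2]. *)
  have H : (\sum_(x in S) d x <= 10)%N.
    have := cover_degree_sum vaS cov2.
    rewrite !big_setU1 /= ?big_set1 ?inE ?(adj_neq va) // -/(d v) -/(d a) dv da.
    rewrite -/(\sum_(x in S) d x).
    move: i1 i2; move: #|nbr G v :&: _| #|nbr G a :&: _| (\sum_(x in S) d x) => *; lia.
  split; first exact: leq_trans H _.
  by apply: leq_trans (sq_bound 3 d3) _; apply: leq_trans (leq_mul (leqnn 3) H) _.
rewrite negb_exists => /forallP d2'.
have d2 x : x \in C -> (d x <= 2)%N.
  move=> xC; have := d3 _ (subsetP CS _ xC); have := d2' x; rewrite xC /=.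
  by rewrite leq_eqVlt => /negPf->.
have cov x y : x \in S -> y \in S -> adj G x y -> (x \in C) || (y \in C).
  move=> xS yS xy; have [xv|xv] := eqVneq x v.
    by rewrite /C !in_setI yS -xv inE [in X in _ || X]inE xy orbT.
  have [yv|yv] := eqVneq y v; last exact: (star3_cover vS dv).
  by rewrite /C !in_setI xS -yv inE adj_sym xy.
have H : (\sum_(x in S) d x <= 12)%N.
  have := cover_degree_sum CS cov; have := sub_sum C 2 CS d2.
  rewrite cC -/(\sum_(x in S) d x) -/(\sum_(x in C) d x).
  by move: (\sum_(x in S) d x) (\sum_(x in C) d x) (\sum_(x in C) _) => *; lia.
split=> //.
have [a [_ [_ [aC _ _ _ _]]]] : exists a b c,
    [/\ a \in C, b \in C, c \in C, a != b & (a != c) && (b != c)].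
  by apply: card3_elements; rewrite cC.
(* A vertex of degree 3 outside the cover [C] is adjacent to all of [C]. *)
have deg3 x : x \in S -> (d x ^ 2 <= 2 * d x + 3 * (x \in nbr G a :&: S))%N.
  move=> xS; have := d3 x xS; rewrite leq_eqVlt => /orP[/eqP dx|dx].
    suff -> : x \in nbr G a :&: S by rewrite dx.
    rewrite in_setI xS andbT inE adj_sym.
    have xC : x \notin C by apply/negP => /d2; rewrite dx.
    have sub : nbr G x :&: S \subset C.
      apply/subsetP => y /setIP[]; rewrite [_ \in nbr _ _]inE => xy yS.
      by have := cov x y xS yS xy; rewrite (negPf xC).
    have /eqP E : nbr G x :&: S == C by rewrite eqEcard sub cC -/(d x) dx.
    by move: aC; rewrite -E => /setIP[+ _]; rewrite inE.
  by rewrite expnS expn1; move: dx; case: (d x) => [|[|[|]]].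
apply: (@leq_trans (\sum_(x in S) (2 * d x + 3 * (x \in nbr G a :&: S)))%N).
  exact: leq_sum.
rewrite big_split /= -!big_distrr /=.
(* As [a] has degree at most 2, the correction term is at most [3 * 2], and the squares sum to at
   most [2 * 12 + 6 = 30]. *)
have : (\sum_(i in S) (i \in nbr G a :&: S) <= 2)%N.
  apply: leq_trans (d2 _ aC); rewrite /d -sum1_card [leqRHS]big_mkcond [leqLHS]big_mkcond.
  by apply: leq_sum => x _; case: (x \in S); case: (x \in _).
move: (\sum_(i in S) (i \in _ : nat)) => r; move: H; move: (\sum_(x in S) d x) => *; lia.
Qed.

End HubTriple.

(** * Subgraphs of the extremal graph *)

(** Each new value is put in place by a transposition that fixes the values already prescribed. *)
Lemma perm_extends (T : finType) (s t : seq T) :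
  uniq s -> uniq t -> size s = size t -> exists p : {perm T}, map p s = t.
Proof.
elim: s t => [|x s IH] [|y t] //=; first by exists 1%g.
move=> /andP[xs us] /andP[yt ut] [st]; have [p pst] := IH t us ut st.
exists (p * tperm (p x) y)%g; rewrite permM tpermL; congr cons.
rewrite -[RHS]pst; apply/eq_in_map => z zs; rewrite permM tpermD //.
  by rewrite (inj_eq perm_inj); apply: contraNneq xs => ->.
by apply: contraNneq yt => ->; rewrite -pst map_f.
Qed.

Lemma perm_to_prefix (n : nat) (u : 'I_n) (s : seq 'I_n) : uniq s ->
  exists f : {perm 'I_n}, forall i, (i < size s)%N -> f (nth u s i) = i :> nat.
Proof.
move=> us; have sn : (size s <= n)%N.
  by rewrite -(card_uniqP us) -[leqRHS]card_ord max_card.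
pose t := [seq widen_ord sn i | i <- enum 'I_(size s)].
have vt : map val t = iota 0 (size s) by rewrite -map_comp -val_enum_ord; apply: eq_map.
have ut : uniq t by rewrite -(map_inj_uniq val_inj) vt iota_uniq.
have st : size s = size t by rewrite size_map size_enum_ord.
have [f fst] := perm_extends us ut st; exists f => i si.
rewrite -(nth_map u u) // fst -[LHS](nth_map u 0%N val) -?st // vt nth_iota //.
Qed.

Definition KH_embeds (n : nat) (G : sgraph n) k : Prop :=
  exists f : {perm 'I_n}, forall x y, adj G x y -> KH_adj n k (f x) (f y).

(** Vertex [u] is sent to 0 and the list [s] to 1, 2, and so on, whence the shift of indices. As 0
    is joined to everything, only edges avoiding [u] impose a condition. *)
Lemma KH_embeds_list (n : nat) (G : sgraph n) k u (s : seq 'I_n) :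
  uniq (u :: s) ->
  (forall x y, x != u -> y != u -> adj G x y -> exists i j,
    [/\ (i < size s)%N, (j < size s)%N, x = nth u s i, y = nth u s j
      & KH_edge k i.+1 j.+1 || KH_edge k j.+1 i.+1]) ->
  KH_embeds G k.
Proof.
move=> us H; have [f fE] := perm_to_prefix u us; exists f => x y xy.
have f0 : f u = 0%N :> nat by apply: (fE 0%N).
rewrite /KH_adj (inj_eq perm_inj) (adj_neq xy) /=.
have [->|xu] := eqVneq x u; first by rewrite /KH_edge f0.
have [->|yu] := eqVneq y u; first by rewrite /KH_edge f0 orbT.
have [i [j [si sj -> -> ij]]] := H x y xu yu xy.
by rewrite (fE i.+1) ?(fE j.+1).
Qed.

(** * Embedding a graph with a dominating vertex in the extremal graph *)

Section HubEmbedding.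
Variables (n : nat) (G : sgraph n) (u : 'I_n).
Hypothesis hub : forall x, x != u -> adj G u x.

Lemma hub_embeds1 : (2 <= n)%N -> ~ has_k_edge_disjoint_cycles G 1 -> KH_embeds G 1.
Proof.
move=> n2 noG; have [w] : exists w, w \in [set~ u].
  by apply/set0Pn; rewrite -card_gt0 cardsC1 card_ord; lia.
rewrite !inE => wu; apply: (@KH_embeds_list _ _ _ u [:: w]).
  by solve_uniq.
move=> x y xu yu xy; case: noG; have ux := hub xu; have uy := hub yu.
by explicit_cycles [:: [:: u; x; y]].
Qed.

Let no2matching a b c d : ~ has_k_edge_disjoint_cycles G 2 ->
  uniq [:: u; a; b; c; d] -> adj G a b -> adj G c d -> False.
Proof.
move=> noG; rewrite /= !inE !negb_or => D ab cd; split_hyps; apply: noG.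
have ua : adj G u a by apply: hub; rewrite eq_sym.
have ub : adj G u b by apply: hub; rewrite eq_sym.
have uc : adj G u c by apply: hub; rewrite eq_sym.
have ud : adj G u d by apply: hub; rewrite eq_sym.
by explicit_cycles [:: [:: u; a; b]; [:: u; c; d]].
Qed.

(** In [G - u] there are neither stars with three leaves nor two disjoint edges, so all edges lie on
    three vertices, where [KH n 2] has the triangle 1, 2, 3. *)
Lemma hub_embeds2 : (4 <= n)%N -> ~ has_k_edge_disjoint_cycles G 2 -> KH_embeds G 2.
Proof.
move=> n4 noG.
suff [v [a [b [D H]]]] : exists v a b, uniq [:: u; v; a; b] /\
    forall x y, x != u -> y != u -> adj G x y -> (x \in [:: v; a; b]) && (y \in [:: v; a; b]).
  apply: (KH_embeds_list D) => x y xu yu xy; have /andP[xs ys] := H x y xu yu xy.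
  exists (index x [:: v; a; b]), (index y [:: v; a; b]).
  rewrite !index_mem !nth_index //; split=> //.
  have : index x [:: v; a; b] != index y [:: v; a; b].
    by apply: contraTneq (adj_neq xy) => E; rewrite -(nth_index u xs) E nth_index ?eqxx.
  have := xs; have := ys; rewrite -!index_mem.
  by case: (index x _) => [|[|[|?]]] //; case: (index y _) => [|[|[|?]]].
have [/existsP[v /andP[vu]]|] := boolP [exists v, (v != u) && (2 <= #|nbr G v :&: [set~ u]|)%N].
  case/subseq_of_card => -[|a [|b [|? ?]]] [] //= _; rewrite inE andbT => ab sN.
  have := sN a; have := sN b; rewrite !inE !eqxx orbT => /(_ isT)/andP[vb bu] /(_ isT)/andP[va au].
  exists v, a, b; split; first by solve_uniq.
  have star y : y != u -> adj G v y -> y \in [:: v; a; b].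
    move=> yu vy; apply/negPn/negP; rewrite !inE !negb_or => /and3P[yv ya yb].
    by apply: noG; apply: (hub_star3 hub (v := v) (a := a) (b := b) (c := y)) => //; solve_uniq.
  move=> x y xu yu xy.
  have [xv|xv] := eqVneq x v; first by rewrite [x \in _]inE xv eqxx star // -xv.
  have [yv|yv] := eqVneq y v.
    by rewrite [y \in _]inE yv eqxx andbT star // -yv adj_sym.
  have meet c : c != u -> adj G v c -> (x == c) || (y == c).
    move=> cu vc; apply/negPn/negP; rewrite negb_or => /andP[xc yc].
    by apply: (no2matching noG _ vc xy); solve_uniq.
  have /orP[] := meet a au va => /eqP; have /orP[] := meet b bu vb => /eqP E1 E2.
  - by rewrite -E1 -E2 eqxx in ab.
  - by rewrite !inE E1 E2 !eqxx !orbT.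
  - by rewrite !inE E1 E2 !eqxx !orbT.
  - by rewrite -E1 -E2 eqxx in ab.
rewrite negb_exists => /forallP d1.
have d1' x y z : x != u -> y != u -> z != u -> adj G x y -> adj G x z -> y = z.
  move=> xu yu zu xy xz; apply/eqP; apply: contraNT (d1 x) => yz; rewrite xu /=.
  have <- : #|[set y; z]| = 2 by rewrite cards2 yz.
  by apply: subset_leq_card; apply/subsetP => w; rewrite !inE => /orP[]/eqP->; rewrite ?xy ?xz.
have pick3 (A : {set 'I_n}) : (#|A| <= 3)%N -> exists w, w \notin A.
  move=> A3; have [w] : exists w, w \in ~: A.
    by apply/set0Pn; rewrite -card_gt0 cardsCs setCK card_ord; lia.
  by rewrite inE; exists w.
have [/existsP[[v a] /= /and3P[va vu au]]|] :=
    boolP [exists e : 'I_n * 'I_n, [&& adj G e.1 e.2, e.1 != u & e.2 != u]].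
  have [|b] := pick3 [set x in [:: u; v; a]].
    by rewrite cardsE; apply: leq_trans (card_size _) _.
  rewrite !inE !negb_or => /and3P[bu bv ba]; exists v, a, b; split; first by solve_uniq.
  move=> x y xu yu xy; apply/negPn/negP => H.
  have av : adj G a v by rewrite adj_sym.
  have yx : adj G y x by rewrite adj_sym.
  have [E|xv] := eqVneq x v.
    by subst x; move: H; rewrite (d1' v y a) // !inE !eqxx orbT.
  have [E|xa] := eqVneq x a.
    by subst x; move: H; rewrite (d1' a y v) // !inE !eqxx orbT.
  have [E|yv] := eqVneq y v.
    by subst y; move: xa; rewrite (d1' v x a) // eqxx.
  have [E|ya] := eqVneq y a.
    by subst y; move: xv; rewrite (d1' a x v) // eqxx.
  by apply: (no2matching noG _ va xy); solve_uniq.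
rewrite negb_exists => /forallP E0.
have [|s [ss us sA]] := @subseq_of_card _ [set~ u] 3.
  by rewrite cardsC1 card_ord; lia.
case: s ss us sA => [|v [|a [|b [|? ?]]]] //= _ us sA; exists v, a, b; split.
  rewrite us andbT; apply/negP => uv; have := sA u; rewrite uv inE.
  by rewrite in_set1 eqxx => /(_ isT).
by move=> x y xu yu xy; have := E0 (x, y); rewrite /= xy xu yu.
Qed.

(** By [hub_star5], [v] has exactly four neighbours besides [u]. Edges of [G - u] off [v] lie inside
    this set [C], by [hub_star_edge], and no two of them meet, by [hub_star_path]. So [v] becomes
    the centre of F_2. *)
Lemma hub_embeds3 v : ~ has_k_edge_disjoint_cycles G 3 -> v != u ->
  (4 <= #|nbr G v :&: [set~ u]|)%N -> KH_embeds G 3.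
Proof.
move=> noG vu; set C := nbr G v :&: [set~ u] => C4.
have inC x : (x \in C) = (adj G v x && (x != u)) by rewrite !inE.
have cC : #|C| = 4.
  apply/eqP; rewrite eqn_leq C4 andbT leqNgt; apply/negP => /subseq_of_card.
  case=> -[|a [|b [|c [|d [|e [|? ?]]]]]] [] //= _ us sC; apply: noG.
  move: (sC a) (sC b) (sC c) (sC d) (sC e); rewrite !(inC, inE) !eqxx !orbT => A1 A2 A3 A4 A5.
  case/andP: (A1 isT) => ? ?; case/andP: (A2 isT) => ? ?; case/andP: (A3 isT) => ? ?.
  case/andP: (A4 isT) => ? ?; case/andP: (A5 isT) => ? ?.
  apply: (hub_star5 hub (v := v) (a := a) (b := b) (c := c) (d := d) (e := e)) => //.
  by rewrite !inE !negb_or in us; split_hyps; solve_uniq.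
have closed x y : x != u -> y != u -> adj G x y -> x != v -> y != v -> x \in C.
  move=> xu yu xy xv yv; apply/negPn/negP => xC.
  (* Even without [y] three leaves remain, and they miss [x] because [x] is outside [C]. *)
  have := @card3_elements _ (C :\ y); case.
    by move: C4; rewrite (cardsD1 y); case: (y \in C); rewrite ?add0n // => /ltnW.
  move=> a [b [c []]]; rewrite !in_setD1 !inC.
  move=> /and3P[ay va au] /and3P[b_y vb bu] /and3P[cy vc cu] ab /andP[ac bc].
  apply: noG; apply: (hub_star_edge hub (v := v) (a := a) (b := b) (c := c)) (xy) => //.
  have xN z : adj G v z -> z != u -> x != z.
    by move=> vz zu; apply: contraNneq xC => ->; rewrite inC vz.
  by have := xN a va au; have := xN b vb bu; have := xN c vc cu => *; solve_uniq.
have no_path x y z : x \in C -> y \in C -> z \in C -> adj G x y -> adj G y z -> x != z -> False.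
  rewrite !inC => /andP[vx xu] /andP[vy yu] /andP[vz zu] xy yz xz.
  have [w] : exists w, w \in C :\: [set x; y; z].
    apply/set0Pn; rewrite -card_gt0 cardsD cC.
    apply: (@leq_trans (4 - 3)) => //; apply: leq_sub => //.
    apply: leq_trans (subset_leq_card (subsetIr _ _)) _.
    apply: leq_trans (leq_card_setU _ _) _; rewrite cards1 cards2; by case: (_ == _).
  rewrite in_setD inC !inE !negb_or -!andbA => /and5P[wx wy wz vw wu].
  apply: noG; apply: (hub_star_path hub (v := v) (a := x) (b := y) (c := z) (d := w)) => //.
  by solve_uniq.
(* The labels are chosen so that an edge inside [C], if any, is [a b]; a second one can then only be
   [c d]. *)
have [a [b [c [d [us sC H]]]]] : exists a b c d, [/\ uniq [:: a; b; c; d],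
    C = [set x in [:: a; b; c; d]] & forall x y, x \in C -> y \in C -> adj G x y ->
      [|| (x == a) && (y == b), (x == b) && (y == a), (x == c) && (y == d) |
          (x == d) && (y == c)]].
  have enumC a b c d : uniq [:: a; b; c; d] -> (forall x, x \in [:: a; b; c; d] -> x \in C) ->
      C = [set x in [:: a; b; c; d]].
    move=> us sC; apply/esym/eqP; rewrite eqEcard cC; apply/andP; split.
      by apply/subsetP => x; rewrite in_set => /sC.
    by rewrite cardsE (card_uniqP us).
  have [/existsP[[a b] /= /and3P[ab aC bC]]|] :=
      boolP [exists e : 'I_n * 'I_n, [&& adj G e.1 e.2, e.1 \in C & e.2 \in C]].
    have [|s [ss us sC]] := @subseq_of_card _ (C :\: [set a; b]) 2.
      rewrite cardsD cC; apply: (@leq_trans (4 - 2)) => //; apply: leq_sub => //.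
      by apply: leq_trans (subset_leq_card (subsetIr _ _)) _; rewrite cards2; case: (_ == _).
    case: s ss us sC => [|c [|d [|? ?]]] //= _; rewrite inE andbT => cd sC.
    have mem z : z \in [:: c; d] -> [&& z != a, z != b & z \in C].
      by move=> /sC; rewrite in_setD in_set2 negb_or => /andP[/andP[-> ->] ->].
    have /and3P[ca cb cC'] := mem c (mem_head _ _).
    have /and3P[da db dC] : [&& d != a, d != b & d \in C].
      by apply: mem; rewrite in_cons mem_head orbT.
    have us : uniq [:: a; b; c; d] by solve_uniq.
    have EC := enumC _ _ _ _ us _; exists a, b, c, d; split=> //.
      by apply: EC => x; rewrite 3!in_cons mem_seq1 => /or4P[]/eqP->.
    have ba : adj G b a by rewrite adj_sym.
    move=> x y xC yC xy; have yx : adj G y x by rewrite adj_sym.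
    have [E|xa] := eqVneq x a.
      subst x; have [//|yb] := eqVneq y b.
      by case: (no_path b a y) => //; rewrite eq_sym.
    have [E|xb] := eqVneq x b.
      subst x; have [E|ya] := eqVneq y a; first by rewrite ?E ?eqxx ?orbT.
      by case: (no_path a b y) => //; rewrite eq_sym.
    have [E|ya] := eqVneq y a.
      by subst y; case: (no_path b a x) => //; rewrite eq_sym.
    have [E|yb] := eqVneq y b.
      by subst y; case: (no_path a b x) => //; rewrite eq_sym.
    have EC' : C = [set x in [:: a; b; c; d]].
      by apply: EC => z; rewrite 3!in_cons mem_seq1 => /or4P[]/eqP->.
    move: xC yC (adj_neq xy); rewrite EC' !inE !(negPf xa, negPf xb, negPf ya, negPf yb) /=.
    by move=> /orP[]/eqP-> /orP[]/eqP->; rewrite !eqxx ?orbT.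
  rewrite negb_exists => /forallP E0.
  have [s [ss us sC]] := subseq_of_card C4.
  case: s ss us sC => [|a [|b [|c [|d [|? ?]]]]] //= _ us sC.
  exists a, b, c, d; split=> //; first exact: enumC.
  by move=> x y xC yC xy; have := E0 (x, y); rewrite /= xy xC yC.
have sub z : z \in [:: a; b; c; d] -> adj G v z && (z != u) by rewrite -inC sC in_set.
apply: (@KH_embeds_list _ _ _ u [:: v; a; b; c; d]).
  have nv : v \notin [:: a; b; c; d] by apply/negP => /sub/andP[/adj_neq]; rewrite eqxx.
  have nu : u \notin [:: v; a; b; c; d].
    by rewrite in_cons negb_or eq_sym vu; apply/negP => /sub/andP[_]; rewrite eqxx.
  by rewrite cons_uniq nu cons_uniq nv us.
have fromv x y : x = v -> y != u -> adj G x y -> exists j,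
    [/\ (j < 4)%N & y = nth u [:: a; b; c; d] j].
  move=> -> yu vy; have : y \in C by rewrite inC vy.
  rewrite sC in_set => yC; exists (index y [:: a; b; c; d]).
  by rewrite nth_index // -[4]/(size [:: a; b; c; d]) index_mem.
move=> x y xu yu xy; have yx : adj G y x by rewrite adj_sym.
have [xv|xv] := eqVneq x v.
  have [j [j4 ->]] := fromv x y xv yu xy; exists 0%N, j.+1; split=> //.
  by rewrite /KH_edge /=; move: j4; case: j => [|[|[|[|]]]].
have [yv|yv] := eqVneq y v.
  have [j [j4 ->]] := fromv y x yv xu yx; exists j.+1, 0%N; split=> //.
  by rewrite /KH_edge /=; move: j4; case: j => [|[|[|[|]]]].
have := H x y (closed x y xu yu xy xv yv) (closed y x yu xu yx yv xv) xy.
case/or4P => /andP[/eqP-> /eqP->].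
- by exists 1%N, 2%N.
- by exists 2%N, 1%N.
- by exists 3%N, 4%N.
- by exists 4%N, 3%N.
Qed.

End HubEmbedding.

Local Open Scope ring_scope.

(** * The spectral radius and subinvariant vectors *)

Lemma normc_ge0 (R : realType) (z : R[i]) : 0 <= Normc.normc z.
Proof. by case: z => a b; apply: sqrtr_ge0. Qed.

Lemma normc_sum (R : realType) (I : finType) (F : I -> R[i]) :
  Normc.normc (\sum_i F i) <= \sum_i Normc.normc (F i).
Proof.
elim/big_rec2: _ => [|i x y _ IH]; first by rewrite Normc.normc0.
by apply: le_trans (le_normcD _ _) _; rewrite lerD2l.
Qed.

Lemma normc_real (R : realType) (a : R) : 0 <= a -> Normc.normc a%:C%C = a.
Proof. by move=> a0; rewrite /= expr0n addr0 sqrtr_sqr ger0_norm. Qed.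

Lemma max_in_seq (R : realType) (T : eqType) (f : T -> R) (r : seq T) :
  r != [::] -> exists2 z, z \in r & forall y, y \in r -> f y <= f z.
Proof.
elim: r => [//|x r IH] _; have [->|/IH[z zr zm]] := eqVneq r [::].
  by exists x; rewrite ?mem_head // => y; rewrite inE => /eqP->.
have [xz|zx] := leP (f x) (f z).
  by exists z; rewrite ?inE ?zr ?orbT // => y; rewrite inE => /orP[/eqP->|/zm].
exists x; rewrite ?mem_head // => y; rewrite inE => /orP[/eqP-> //|/zm yz].
exact: le_trans yz (ltW zx).
Qed.

(** The characteristic polynomial splits over [R[i]], so the spectrum is a finite list, nonempty as
    the degree is [n], and the supremum is a maximum. *)
Lemma spectral_radius_attained (R : realType) (n : nat) (A : 'M[R]_n) : (0 < n)%N ->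
  exists z : R[i], [/\ eigenvalue (map_mx (real_complex R) A) z,
    Normc.normc z = spectral_radius A &
    forall y, eigenvalue (map_mx (real_complex R) A) y ->
      Normc.normc y <= spectral_radius A].
Proof.
move=> n0; set B := map_mx _ A.
have [r Dr] := closed_field_poly_normal (char_poly B).
have lB : lead_coef (char_poly B) = 1 by apply/monicP/char_poly_monic.
have er y : eigenvalue B y = (y \in r).
  by rewrite eigenvalue_root_char Dr lB scale1r root_prod_XsubC.
have r0 : r != [::].
  apply: contraTneq n0 => r0; have := size_char_poly B.
  by rewrite Dr lB scale1r r0 big_nil size_poly1 => -[<-].
have [z zr zm] := max_in_seq (@Normc.normc R) r0.
have ub : ubound [set Normc.normc y | y in [set y | eigenvalue B y]]%classic (Normc.normc z).
  by move=> _ [y /= + <-]; rewrite er => /zm.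
have zin : [set Normc.normc y | y in [set y | eigenvalue B y]]%classic (Normc.normc z).
  by exists z => //=; rewrite er.
have E : Normc.normc z = spectral_radius A.
  apply/le_anti/andP; split.
    by apply: ub_le_sup => //; exists (Normc.normc z).
  by apply: ge_sup => //; exists (Normc.normc z).
by exists z; split; rewrite ?er // => y; rewrite er -E => /zm.
Qed.

Section Rho.
Variables (R : realType) (n : nat) (G : sgraph n).
Hypothesis n0 : (0 < n)%N.

(** The vector consists of the moduli of a complex eigenvector whose eigenvalue has modulus
    [rho R G]; the inequality is the triangle inequality. *)
Lemma rho_subinvariant : exists x : 'I_n -> R,
  [/\ forall i, 0 <= x i, exists i, 0 < x i &
      forall i, rho R G * x i <= \sum_j (adj G i j)%:R * x j].
Proof.
have [z [/eigenvalueP[v vE v0] zE _]] := spectral_radius_attained (adjmx R G) n0.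
exists (fun i => Normc.normc (v 0 i)); split.
- by move=> i; apply: normc_ge0.
- have [i vi] : exists i, v 0 i != 0.
    apply/existsP; apply: contraR v0; rewrite negb_exists => /forallP v0.
    by apply/eqP/rowP => i; rewrite mxE; apply/eqP; have := v0 i; rewrite negbK.
  exists i; rewrite lt_neqAle normc_ge0 andbT eq_sym.
  by apply: contraNneq vi => /Normc.eq0_normc ->.
- move=> i; rewrite /rho -zE -Normc.normcM.
  have := congr1 (fun w : 'rV_n => w 0 i) vE; rewrite !mxE => <-.
  apply: le_trans (normc_sum _) _; apply: ler_sum => j _.
  rewrite Normc.normcM !mxE mulrC adj_sym.
  by rewrite (_ : Normc.normc _ = (adj G i j)%:R) // normc_real.
Qed.

Lemma rho_ge_eigenvalue (lam : R) (y : 'I_n -> R) : 0 <= lam ->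
  (exists i, y i != 0) -> (forall i, lam * y i = \sum_j (adj G i j)%:R * y j) ->
  lam <= rho R G.
Proof.
move=> lam0 [i yi] yE.
have [_ [_ _ ub]] := spectral_radius_attained (adjmx R G) n0.
rewrite -[lam]normc_real //; apply: ub; rewrite eigenvalue_map.
apply/eigenvalueP; exists (\row_j y j).
  apply/rowP => j; rewrite !mxE yE; apply: eq_bigr => k _.
  by rewrite !mxE mulrC adj_sym.
by apply: contraNneq yi => /rowP/(_ i); rewrite !mxE => ->.
Qed.

End Rho.

(** * The Perron vector of the extremal graph *)

(** Adjacency on [nat], so that sums over the vertices can be split at [2 * k] and expanded by
    computation. *)
Definition KH_adjn (k i j : nat) : bool :=
  (i != j) && (KH_edge k i j || KH_edge k j i).

Lemma KH_adjn_sym k i j : KH_adjn k i j = KH_adjn k j i.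
Proof. by rewrite /KH_adjn eq_sym orbC. Qed.

Lemma KH_adjn_outer k i j : (0 < k)%N -> (2 * k <= j)%N -> KH_adjn k i j = (i == 0)%N.
Proof.
move=> k0 kj; rewrite /KH_adjn /KH_edge [(j < 2 * k)%N]ltnNge kj !andbF !orbF /=.
have -> : (j == 0)%N = false by lia.
have -> : (j == 1)%N = false by lia.
by rewrite /= ?andbF ?orbF; case: (i =P 0%N) => [->|]; rewrite ?andbF ?andbT //; case: j kj; lia.
Qed.

Section KHVector.
Variables (R : realType) (lam : R).

(** Entry at the triangle vertices other than 1, when the entry at 0 is 1: it solves
    [lam * b = 1 + (2 * k - 2) * c] and [lam * c = 1 + b + c], with [b] the entry at 1. *)
Definition KH_c k : R := (lam + 1) / (lam ^+ 2 - lam - (2 * k - 2)%:R).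

Definition KH_b k : R := (1 + (2 * k - 2)%:R * KH_c k) / lam.

Definition KH_vec k (j : nat) : R :=
  if j == 0%N then 1 else if j == 1%N then KH_b k else
  if (j < 2 * k)%N then KH_c k else lam^-1.

(** The displayed quartic equation is the eigenvalue equation at vertex 0 cleared of denominators;
    the equations at the other vertices hold by the choice of the entries. *)
Lemma KH_vec_eigen k n (i : nat) : (1 <= k <= 3)%N -> (2 * k <= n)%N -> 0 < lam ->
  0 < lam ^+ 2 - lam - (2 * k - 2)%:R ->
  (lam ^+ 2 - (n%:R - 1) + (2 * k - 2)%:R) * (lam ^+ 2 - lam - (2 * k - 2)%:R) =
    (2 * k - 2)%:R * (lam + 1) ^+ 2 ->
  lam * KH_vec k i = \sum_(0 <= j < n) (KH_adjn k i j)%:R * KH_vec k j.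
Proof.
move=> k13 kn lam0 q0 ch; have k0 : (0 < k)%N by case/andP: k13.
have ln0 : lam != 0 by rewrite gt_eqF.
have bE : lam * KH_b k = 1 + (2 * k - 2)%:R * KH_c k by rewrite mulrC divfK.
have cE : lam * KH_c k = 1 + KH_b k + KH_c k.
  rewrite /KH_b /KH_c; field; by rewrite ln0 gt_eqF.
have aE : lam = KH_b k + (2 * k - 2)%:R * KH_c k + (n - 2 * k)%:R * lam^-1.
  have nE : (n - 2 * k)%:R = n%:R - 2 - (2 * k - 2)%:R :> R.
    by rewrite -[2]/(2%:R) -!natrB; try lia; congr (_%:R); lia.
  rewrite nE; apply: (mulfI ln0); rewrite !mulrDr bE.
  have cq : KH_c k * (lam ^+ 2 - lam - (2 * k - 2)%:R) = lam + 1.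
    by rewrite divfK // gt_eqF.
  have {}ch : lam ^+ 2 - (n%:R - 1) + (2 * k - 2)%:R = (2 * k - 2)%:R * KH_c k * (lam + 1).
    apply: (mulIf (lt0r_neq0 q0)); rewrite ch; move: cq; set q := lam ^+ 2 - _ - _ => cq.
    by rewrite -cq; ring.
  rewrite [lam * (_ * lam^-1)]mulrCA divff // mulr1.
  move: ch; rewrite expr2 => ch; rewrite -[LHS](addrK (- (n%:R - 1) + (2 * k - 2)%:R)).
  by rewrite addrA ch; ring.
rewrite (big_cat_nat (n := (2 * k)%N)) //=.
have -> : \sum_(2 * k <= j < n) (KH_adjn k i j)%:R * KH_vec k j =
    (i == 0%N)%:R * ((n - 2 * k)%:R * lam^-1).
  rewrite (eq_big_nat _ _ (F2 := fun=> (i == 0%N)%:R * lam^-1)).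
    by rewrite sumr_const_nat -mulr_natl; ring.
  move=> j /andP[kj _]; rewrite KH_adjn_outer // /KH_vec ltnNge kj /=.
  by case: j kj => [|[|j]] //; lia.
have [ik|ik] := leqP (2 * k) i.
  under eq_bigr => j _ do rewrite KH_adjn_sym KH_adjn_outer //.
  have -> : KH_vec k i = lam^-1 by rewrite /KH_vec ltnNge ik; case: i ik => [|[|i]] //; lia.
  have -> : (i == 0)%N = false by lia.
  rewrite divff // mul0r addr0 big_ltn; last lia.
  rewrite /= mul1r big_nat big1 ?addr0 // => j /andP[j1 _].
  by rewrite (_ : (j == 0)%N = false) ?mul0r //; lia.
move: k13 => /andP[_]; case: k k0 kn ik q0 ch bE cE aE => [|[|[|[|]]]] // _ kn ik q0 ch bE cE aE _.
- rewrite -[(2 * 1 - 2)%N]/0%N in bE aE.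
  case: i ik => [|[|]] // _; rewrite unlock /= /KH_adjn /KH_vec /=.
  + by rewrite mulr1 {1}aE; ring.
  + by rewrite bE; ring.
- rewrite -[(2 * 2 - 2)%N]/2%N in bE aE.
  case: i ik => [|[|[|[|]]]] // _; rewrite unlock /= /KH_adjn /KH_vec /=.
  + by rewrite mulr1 {1}aE; ring.
  + by rewrite bE; ring.
  + by rewrite cE; ring.
  + by rewrite cE; ring.
- rewrite -[(2 * 3 - 2)%N]/4%N in bE aE.
  case: i ik => [|[|[|[|[|[|]]]]]] // _; rewrite unlock /= /KH_adjn /KH_vec /=.
  + by rewrite mulr1 {1}aE; ring.
  + by rewrite bE; ring.
  + by rewrite cE; ring.
  + by rewrite cE; ring.
  + by rewrite cE; ring.
  + by rewrite cE; ring.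
Qed.

End KHVector.

(** The eigenvalue is a root of the quartic of [KH_vec_eigen], found by the intermediate value
    theorem. For [k = 3], subtracting [4 * (lam ^+ 2 - lam - 4)] from both sides gives the last
    equation. *)
Lemma KH_eigenvector (R : realType) (k n : nat) :
  (1 <= k <= 3)%N -> (64 * k ^ 6 <= n)%N ->
  exists (lam : R) (y : 'I_n -> R),
  [/\ 0 < lam, n%:R - 1 <= lam ^+ 2, forall i, 0 < y i,
      forall i, lam * y i = \sum_j (KH_adj n k i j)%:R * y j
    & k = 3 -> (lam ^+ 2 - (n%:R - 1)) * (lam ^+ 2 - lam - 4) = 4 * (3 * lam + 5)].
Proof.
move=> k13 kn; have k0 : (0 < k)%N by case/andP: k13.
have n64 : (64 <= n)%N.
  by apply: leq_trans kn; rewrite -{1}[64%N]muln1 leq_mul2l /= expn_gt0 k0.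
pose m : R := (2 * k - 2)%:R; pose N : R := n%:R.
have N64 : 64 <= N by rewrite /N (ler_nat R 64).
have m0 : 0 <= m by rewrite /m ler0n.
have m4 : m <= 4 by rewrite /m (ler_nat R _ 4); lia.
pose s := Num.sqrt (N - 1).
have s2 : s ^+ 2 = N - 1 by rewrite sqr_sqrtr //; lra.
have s0 : 0 <= s by apply: sqrtr_ge0.
have s7 : 7 <= s by nra.
pose p : {poly R} := ('X^2 + (m - (N - 1))%:P) * ('X^2 - 'X - m%:P) - m%:P * ('X + 1) ^+ 2.
have pE x : p.[x] = (x ^+ 2 + (m - (N - 1))) * (x ^+ 2 - x - m) - m * (x + 1) ^+ 2.
  by rewrite /p !hornerE.
(* The value of [p] is [- m * (3 * s + m + 1) <= 0] at [s] and nonnegative at [N]. That the root is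
   at least [s] gives [N - 1 <= lam ^+ 2]. *)
have [||lam /andP[slam _] /rootP] := @poly_ivt _ p s N.
- by nra.
- rewrite !pE; apply/andP; split.
    rewrite s2 (_ : N - 1 + (m - (N - 1)) = m); last by ring.
    rewrite (_ : _ - _ = m * (N - 1 - s - m - (s + 1) ^+ 2)); last by ring.
    apply: mulr_ge0_le0 => //; rewrite sqrrD s2; lra.
  have A1 : 63 * N <= N ^+ 2 + (m - (N - 1)) by nra.
  have A2 : 62 * N <= N ^+ 2 - N - m by nra.
  have A3 : (63 * N) * (62 * N) <= (N ^+ 2 + (m - (N - 1))) * (N ^+ 2 - N - m).
    by apply: ler_pM => //; lra.
  have A4 : m * (N + 1) ^+ 2 <= 4 * (N + 1) ^+ 2 by rewrite ler_wpM2r ?sqr_ge0.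
  by nra.
rewrite pE => plam.
have lam7 : 7 <= lam by lra.
have q0 : 0 < lam ^+ 2 - lam - m by nra.
have ch : (lam ^+ 2 - (N - 1) + m) * (lam ^+ 2 - lam - m) = m * (lam + 1) ^+ 2.
  by apply/eqP; rewrite -subr_eq0 -plam; apply/eqP; ring.
have lam0 : 0 < lam by lra.
exists lam, (fun i => KH_vec lam k i); split => //.
- by rewrite -/N -s2 ler_sqr ?nnegrE //; lra.
- have c0 : 0 < KH_c lam k by rewrite /KH_c divr_gt0 //; lra.
  move=> i; rewrite /KH_vec; case: ifP => // _; case: ifP => _.
    by apply: divr_gt0 => //; apply: ltr_pwDl => //; apply: mulr_ge0 => //; apply: ltW.
  by case: ifP; rewrite ?invr_gt0.
- move=> i; rewrite (@KH_vec_eigen _ _ k n i) ?big_mkord //.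
  by apply: leq_trans kn; case/andP: k13 => _; case: (k) k0 => [|[|[|[|]]]].
- move=> k3; move: ch; rewrite /m k3 (_ : (2 * 3 - 2)%:R = 4 :> R) // => ch.
  rewrite -/N; move: ch; set T := lam ^+ 2 - (N - 1); rewrite mulrDl => ch.
  by apply: (addIr (4 * (lam ^+ 2 - lam - 4))); rewrite ch; ring.
Qed.

(** * Comparison with the positive eigenvector of the extremal graph *)

Lemma KH_sum_perm (R : realType) (n k : nat) (f : {perm 'I_n}) (lam : R) (y : 'I_n -> R) :
  (forall i, lam * y i = \sum_j (KH_adj n k i j)%:R * y j) ->
  forall i, lam * y (f i) = \sum_j (KH_adj n k (f i) (f j))%:R * y (f j).
Proof. by move=> yE i; rewrite yE (reindex_inj (@perm_inj _ f)). Qed.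

Section EmbeddedInKH.
Variables (R : realType) (n k : nat) (G : sgraph n) (f : {perm 'I_n}).
Variables (lam : R) (y : 'I_n -> R).
Hypotheses (n0 : (0 < n)%N) (y0 : forall i, 0 < y i).
Hypothesis yE : forall i, lam * y i = \sum_j (KH_adj n k i j)%:R * y j.
Hypothesis fG : forall i j, adj G i j -> KH_adj n k (f i) (f j).

Let pairing_lam (x : 'I_n -> R) :
  \sum_i \sum_j (KH_adj n k (f i) (f j))%:R * (y (f i) * x j) = lam * \sum_i y (f i) * x i.
Proof.
rewrite exchange_big big_distrr; apply: eq_bigr => j _ /=.
rewrite mulrA (KH_sum_perm f yE) big_distrl; apply: eq_bigr => i _ /=.
by rewrite KH_adj_sym mulrA.
Qed.

Let adj_le_KH (x : 'I_n -> R) i j : 0 <= x j ->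
  (adj G i j)%:R * (y (f i) * x j) <= (KH_adj n k (f i) (f j))%:R * (y (f i) * x j).
Proof.
move=> xj; apply: ler_wpM2r; first by rewrite mulr_ge0 // ltW.
rewrite ler_nat.
by have := @fG i j; case: (adj G i j) => // ->.
Qed.

Let pairing_pos (x : 'I_n -> R) : (forall i, 0 <= x i) -> (exists i, 0 < x i) ->
  0 < \sum_i y (f i) * x i.
Proof.
move=> x0 [i xi]; rewrite (bigD1 i) //= ltr_pwDl ?mulr_gt0 //.
by apply: sumr_ge0 => j _; rewrite mulr_ge0 // ltW.
Qed.

(** Pairing the subinvariant vector [x] of [G] with [y] bounds [rho R G] times the pairing by [lam]
    times the pairing, which is positive. *)
Lemma embedded_rho_le : rho R G <= lam.
Proof.
have [x [x0 xpos xE]] := rho_subinvariant R G n0.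
rewrite -(ler_pM2r (pairing_pos x0 xpos)) -pairing_lam big_distrr /=.
apply: ler_sum => i _ /=; rewrite mulrCA.
apply: le_trans (_ : y (f i) * \sum_j (adj G i j)%:R * x j <= _).
  by rewrite ler_wpM2l // ltW.
by rewrite big_distrr; apply: ler_sum => j _ /=; rewrite mulrCA; apply: adj_le_KH.
Qed.

(** The slacks [a] of subinvariance and [b] of the missing edges are nonnegative with sum 0. So [x]
    is an eigenvector, the dominating vertex makes it positive, and [b = 0] then excludes missing
    edges. *)
Lemma embedded_rho_eq u : (forall w, w != u -> adj G u w) -> 0 < lam ->
  lam <= rho R G -> isomorphic G (KH n k).
Proof.
move=> hub lam0 lamG; have rE : rho R G = lam by apply/le_anti; rewrite lamG embedded_rho_le.
have [x [x0 xpos]] := rho_subinvariant R G n0; rewrite rE => xE.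
pose a i := y (f i) * (\sum_j (adj G i j)%:R * x j - lam * x i).
pose b i := \sum_j ((KH_adj n k (f i) (f j))%:R - (adj G i j)%:R) * (y (f i) * x j).
have a0 i : 0 <= a i by rewrite mulr_ge0 ?subr_ge0 // ltW.
have bt0 i j : 0 <= ((KH_adj n k (f i) (f j))%:R - (adj G i j)%:R) * (y (f i) * x j).
  by rewrite mulrBl subr_ge0 adj_le_KH.
have b0 i : 0 <= b i by apply: sumr_ge0.
have ab i : a i + b i =
    \sum_j (KH_adj n k (f i) (f j))%:R * (y (f i) * x j) - lam * (y (f i) * x i).
  rewrite /a mulrBr [y _ * (lam * _)]mulrCA addrAC; congr (_ - _).
  rewrite big_distrr -big_split; apply: eq_bigr => j _ /=; by ring.
have sab : \sum_i (a i + b i) = 0.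
  by rewrite (eq_bigr _ (fun i _ => ab i)) sumrB pairing_lam big_distrr subrr.
have ab0 i : a i + b i = 0.
  move/eqP: sab; rewrite psumr_eq0 => [/allP/(_ i)|j _]; last by rewrite addr_ge0.
  by rewrite mem_index_enum => /(_ isT)/eqP.
have ai i : a i = 0 by apply/le_anti; rewrite a0 -(ab0 i) lerDl b0.
have bi i : b i = 0 by rewrite -[RHS](ab0 i) ai add0r.
have xE' i : lam * x i = \sum_j (adj G i j)%:R * x j.
  have /eqP := ai i; rewrite /a mulf_eq0 gt_eqF //= subr_eq0 => /eqP->//.
have ge_adj i j : adj G i j -> x j <= lam * x i.
  move=> ij; rewrite xE' (bigD1 j) //= ij mul1r lerDl.
  by apply: sumr_ge0 => l _; rewrite mulr_ge0.
have xu : 0 < x u.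
  have [i xi] := xpos; have [<-//|iu] := eqVneq i u.
  by rewrite -(pmulr_rgt0 _ lam0); apply: lt_le_trans xi (ge_adj _ _ (hub _ iu)).
have xp i : 0 < x i.
  have [->//|iu] := eqVneq i u.
  rewrite -(pmulr_rgt0 _ lam0); apply: lt_le_trans xu (ge_adj _ _ _).
  by rewrite adj_sym hub.
exists f => i j; apply/idP/idP => [/fG//|Kij]; apply/negPn/negP => nij.
have /eqP := bi i; rewrite /b psumr_eq0 // => /allP/(_ j); rewrite mem_index_enum => /(_ isT).
move: Kij; rewrite /= => ->; rewrite (negPf nij) subr0 mul1r.
by rewrite mulf_eq0 !gt_eqF.
Qed.

End EmbeddedInKH.

Lemma isomorphic_KH_rho (R : realType) (n k : nat) (G : sgraph n) (lam : R) (y : 'I_n -> R) :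
  (0 < n)%N -> 0 < lam -> (forall i, 0 < y i) ->
  (forall i, lam * y i = \sum_j (KH_adj n k i j)%:R * y j) ->
  isomorphic G (KH n k) -> rho R G = lam.
Proof.
move=> n0 lam0 y0 yE [f fE]; apply/le_anti; rewrite (@embedded_rho_le R n k G f lam y) //=.
  apply: (@rho_ge_eigenvalue R n G n0 lam (fun i => y (f i))); first exact: ltW.
    by exists (Ordinal n0); rewrite gt_eqF.
  by move=> i; rewrite (KH_sum_perm f yE); apply: eq_bigr => j _; rewrite fE.
by move=> i j; rewrite fE.
Qed.

(** * Existence of a dominating vertex *)

Lemma card_nbr_sum (R : realType) (n : nat) (G : sgraph n) i :
  #|nbr G i|%:R = \sum_j (adj G i j)%:R :> R.
Proof. by rewrite -[nbr G i]setIT card_nbrI natr_sum; apply: eq_bigl => j; rewrite inE. Qed.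

Lemma codeg_sum (R : realType) (n : nat) (G : sgraph n) i j :
  (codeg G i j)%:R = \sum_l (adj G i l)%:R * (adj G l j)%:R :> R.
Proof.
rewrite /codeg card_nbrI natr_sum big_mkcond; apply: eq_bigr => l _ /=.
by rewrite inE (adj_sym G l j); case: (adj G i l); case: (adj G j l); rewrite ?mul0r ?mulr0 ?mul1r.
Qed.

Lemma codegxx (n : nat) (G : sgraph n) i : codeg G i i = #|nbr G i|.
Proof. by rewrite /codeg setIid. Qed.

(* [r] is the spectral radius, [N] the order, [S] the sum of the entries of an
   eigenvector with maximal entry 1 at [u], [M] its next largest entry and [D] the
   number of non-neighbours of [u]. *)
Lemma few_nonneighbours (R : realType) (k : nat) (r N S M D : R) :
  (1 <= k <= 3)%N -> (64 * k ^ 6)%:R <= N -> 0 < r -> N - 1 <= r ^+ 2 ->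
  0 <= M -> 0 <= D -> r * S <= (2 * k)%:R * N ->
  r ^+ 2 <= N - 1 - D + (2 * k - 1)%:R * S ->
  r ^+ 2 * M <= (D + (2 * k)%:R) * M + (2 * k - 1)%:R * S ->
  r ^+ 2 <= N - 1 - D + M * ((4 * (k - 1) * (2 * k - 1))%:R + (2 * k - 1)%:R * D) ->
  r * M <= 1 + (D + (2 * k)%:R) * M -> D < 1.
Proof.
move=> /andP[k1 k3] HN r0 Nr M0 D0 rS rT r2M rD rM.
(* In each case [S] is at most about [2 * k * r], so [D] is of order [r] and [M <= 1 / (2 * k)].
   Then [D <= 4 * (k - 1) * (2 * k - 1)], and the last hypothesis sharpens [M]. For [k = 1] that
   constant is 0 and [M <= 1 / 2] suffices. *)
case: k k1 k3 HN rS rT r2M rD rM => [|[|[|[|]]]] // _ _ HN rS rT r2M rD rM.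
- move: HN rS rT r2M rD rM; rewrite natrM natrX.
  rewrite (_ : (2 * 1)%:R = 2 :> R) // (_ : (2 * 1 - 1)%:R = 1 :> R) //.
  rewrite (_ : (4 * (1 - 1) * (2 * 1 - 1))%:R = 0 :> R) // => HN rS rT r2M rD rM.
  (* Decimal lower bound for the root of 63; for [k = 2] and [k = 3] the roots are those of 4095 and
     46655. *)
  have r7 : 79 <= 10 * r by nra.
  have S1 : S <= 2 * r + 1 by nra.
  have M1 : 2 * M <= 1.
    have : M * (r ^+ 2 - D - 2) * 2 <= r ^+ 2 - D - 2 by nra.
    have q0 : 0 < r ^+ 2 - D - 2 by nra.
    by nra.
  by nra.
- move: HN rS rT r2M rD rM; rewrite natrM natrX.
  rewrite (_ : (2 * 2)%:R = 4 :> R) // (_ : (2 * 2 - 1)%:R = 3 :> R) //.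
  rewrite (_ : (4 * (2 - 1) * (2 * 2 - 1))%:R = 12 :> R) // => HN rS rT r2M rD rM.
  have r7 : 639 <= 10 * r by nra.
  have S1 : 3 * S <= 12 * r + 1 by nra.
  have M1 : 4 * M <= 1.
    have q0 : 0 < r ^+ 2 - D - 4 by nra.
    have : M * (r ^+ 2 - D - 4) * 4 <= r ^+ 2 - D - 4 by nra.
    by nra.
  have D1 : D <= 12 by nra.
  (* Here [r - D - 4 >= 63.9 - 16]; for [k = 3] the difference is at least [215.9 - 46]. *)
  have M2 : 47 * M <= 1 by nra.
  by nra.
- move: HN rS rT r2M rD rM; rewrite natrM natrX.
  rewrite (_ : (2 * 3)%:R = 6 :> R) // (_ : (2 * 3 - 1)%:R = 5 :> R) //.
  rewrite (_ : (4 * (3 - 1) * (2 * 3 - 1))%:R = 40 :> R) // => HN rS rT r2M rD rM.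
  have r7 : 2159 <= 10 * r by nra.
  have S1 : 5 * S <= 30 * r + 1 by nra.
  have M1 : 6 * M <= 1.
    have q0 : 0 < r ^+ 2 - D - 6 by nra.
    have : M * (r ^+ 2 - D - 6) * 6 <= r ^+ 2 - D - 6 by nra.
    by nra.
  have D1 : D <= 40 by nra.
  have M2 : 169 * M <= 1 by nra.
  by nra.
Qed.

Lemma scale_subinvariant (R : realType) (n : nat) (G : sgraph n) (r a : R) (x : 'I_n -> R) :
  0 <= a -> (forall i, r * x i <= \sum_j (adj G i j)%:R * x j) ->
  forall i, r * (a * x i) <= \sum_j (adj G i j)%:R * (a * x j).
Proof.
move=> a0 xE i; rewrite mulrCA; apply: le_trans (ler_wpM2l a0 (xE i)) _.
by rewrite big_distrr; apply: ler_sum => j _ /=; rewrite mulrCA.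
Qed.

Section Dominating.
Variables (R : realType) (k n : nat) (G : sgraph n) (r : R) (x : 'I_n -> R) (u : 'I_n).
Hypotheses (k13 : (1 <= k <= 3)%N) (kn : (64 * k ^ 6 <= n)%N).
Hypothesis noG : ~ has_k_edge_disjoint_cycles G k.
Hypotheses (r0 : 0 < r) (rn : n%:R - 1 <= r ^+ 2).
Hypotheses (x0 : forall i, 0 <= x i) (x1 : forall i, x i <= 1) (xu : x u = 1).
Hypothesis xE : forall i, r * x i <= \sum_j (adj G i j)%:R * x j.

Let S := \sum_i x i.
Let D := #|~: (u |: nbr G u)|.
Let deg i := #|nbr G i|.

Let k0 : (0 < k)%N. Proof. by case/andP: k13. Qed.
Let n0 : (0 < n)%N. Proof. exact: leq_ltn_trans (ltn_ord u). Qed.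

(** Summing the inequalities over all vertices gives at most the degree sum, which [dense_cycles]
    bounds. *)
Let bound_S : r * S <= (2 * k)%:R * n%:R.
Proof.
rewrite /S big_distrr /=; apply: le_trans (ler_sum _ (fun i _ => xE i)) _.
rewrite exchange_big /=; apply: (@le_trans _ _ (\sum_j (deg j)%:R)).
  apply: ler_sum => j _; rewrite -big_distrl /= card_nbr_sum.
  rewrite (eq_bigr (fun i => (adj G j i)%:R)) => [|i _]; last by rewrite adj_sym.
  by rewrite ler_piMr // sumr_ge0.
rewrite -natr_sum -natrM ler_nat leqNgt; apply/negP => H; apply: noG.
exact: dense_cycles n0 (ltnW H).
Qed.

Let two_steps w : r ^+ 2 * x w <= \sum_i (codeg G w i)%:R * x i.
Proof.
rewrite expr2 -mulrA; apply: le_trans (ler_wpM2l (ltW r0) (xE w)) _.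
rewrite big_distrr /=.
apply: (@le_trans _ _ (\sum_l \sum_i (adj G w l)%:R * ((adj G l i)%:R * x i))).
  apply: ler_sum => l _; rewrite mulrCA -big_distrr /=.
  by apply: ler_wpM2l.
rewrite exchange_big /=; apply: ler_sum => i _.
rewrite codeg_sum big_distrl /=; apply: ler_sum => l _.
by rewrite mulrA.
Qed.

Let degu : (deg u + D + 1 = n)%N.
Proof.
have := cardsC (u |: nbr G u); rewrite card_ord cardsU1 inE adj_irr /= -/D -/(deg u).
by lia.
Qed.

Let two_steps_S w : r ^+ 2 * x w <= (deg w)%:R * x w + (2 * k - 1)%:R * S.
Proof.
apply: le_trans (two_steps w) _; rewrite (bigD1 w) //= codegxx lerD2l.
rewrite /S big_distrr [leRHS](bigD1 w) //=; rewrite -[leLHS]add0r.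
apply: lerD; first by rewrite mulr_ge0.
apply: ler_sum => i iw; apply: ler_wpM2r => //.
by rewrite ler_nat codeg_bound // eq_sym.
Qed.

(** A neighbour of [w] is [u], a common neighbour with [u], or one of the [D] non-neighbours of [u]:
    at most [1 + (2 * k - 1) + D]. *)
Let deg_bound w : w != u -> (deg w <= D + 2 * k)%N.
Proof.
move=> wu; have : nbr G w \subset (nbr G w :&: nbr G u) :|: ~: (u |: nbr G u) :|: [set u].
  apply/subsetP => z; rewrite !inE => wz; rewrite wz.
  by case: (z == u); case: (adj G u z).
move/subset_leq_card => H; apply: leq_trans H _.
apply: leq_trans (leq_card_setU _ _) _; rewrite cards1.
rewrite addn1; apply: leq_ltn_trans (leq_card_setU _ _) _; rewrite -/D addnC ltn_add2l.
by apply: leq_ltn_trans (codeg_bound k0 noG wu) _; lia.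
Qed.

(** With [M] the largest entry off [u], walks of length 1 and 2 from [u] and from [m] supply the
    hypotheses of [few_nonneighbours]; the integer [D < 1] is then 0. *)
Lemma maximal_vertex_dominates w : w != u -> adj G u w.
Proof.
move=> wu.
have [m mu xm] : exists2 m, m != u & forall i, i != u -> x i <= x m.
  by case: (@Order.TotalTheory.arg_maxP _ _ _ w (fun i => i != u) x wu) => m mu mm; exists m.
have rest (c : 'I_n -> nat) :
    \sum_i (c i)%:R * x i <= (c u)%:R + (\sum_(i | i != u) c i)%:R * x m.
  rewrite (bigD1 u) //= xu mulr1 lerD2l natr_sum big_distrl /=.
  by apply: ler_sum => i iu; apply: ler_wpM2l => //; apply: xm.
suff : D%:R < 1 :> R.
  rewrite (ltr_nat R D 1) ltnS leqn0 cards_eq0 => /eqP/setP/(_ w).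
  by rewrite !inE (negPf wu) /= => /negbFE.
have degN i : i = u -> (deg i)%:R = n%:R - 1 - D%:R :> R.
  by move->; rewrite -degu !natrD; ring.
apply: (@few_nonneighbours _ k r n%:R S (x m)) => //.
- by rewrite ler_nat.
- by have := two_steps_S u; rewrite xu !mulr1 degN.
- apply: le_trans (two_steps_S m) _; rewrite lerD2r ler_wpM2r //.
  by rewrite -natrD ler_nat deg_bound.
- have := two_steps u; rewrite xu mulr1 => /le_trans; apply.
  apply: le_trans (rest (codeg G u)) _; rewrite codegxx degN // lerD2l mulrC.
  apply: ler_wpM2l => //; rewrite -natrM -natrD ler_nat.
  (* Over the neighbours of [u] the codegrees sum to the degrees inside the neighbourhood; each of
     the [D] other vertices contributes at most [2 * k - 1]. *)
  rewrite (bigID (fun i => i \in nbr G u)) /=; apply: leq_add.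
    apply: leq_trans (nbhd_edges_bound u k0 noG).
    rewrite [leqRHS](bigID (fun i => i != u)) /= -[leqLHS]addn0; apply: leq_add => //.
    rewrite (eq_bigl (fun i => (i \in nbr G u) && (i != u))) => [|i]; last by rewrite andbC.
    by apply: leq_sum => i _; rewrite /codeg setIC.
  rewrite mulnC -sum_nat_const.
  rewrite [leqRHS](eq_bigl (fun i => (i != u) && (i \notin nbr G u))) => [|i].
    by apply: leq_sum => i /andP[iu _]; rewrite codeg_bound // eq_sym.
  by rewrite !inE negb_or.
- apply: le_trans (xE m) _; apply: le_trans (rest (fun i => adj G m i)) _.
  apply: lerD; first by rewrite (ler_nat R _ 1); case: (adj G m u).
  apply: ler_wpM2r => //; rewrite -natrD ler_nat; apply: leq_trans (deg_bound mu).
  rewrite /deg -[nbr G m]setIT card_nbrI big_mkcond [leqRHS](eq_bigl xpredT) => [|i].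
    by apply: leq_sum => i _; case: ifP.
  by rewrite inE.
Qed.

End Dominating.

Lemma dominating_vertex (R : realType) (k n : nat) (G : sgraph n) :
  (1 <= k <= 3)%N -> (64 * k ^ 6 <= n)%N -> ~ has_k_edge_disjoint_cycles G k ->
  0 < rho R G -> n%:R - 1 <= rho R G ^+ 2 ->
  exists u, forall w, w != u -> adj G u w.
Proof.
move=> k13 kn noG r0 rn.
have n0 : (0 < n)%N by apply: leq_trans kn; rewrite muln_gt0 expn_gt0; case/andP: k13 => ->.
have [x [x0 [i xi] xE]] := rho_subinvariant R G n0.
have [u _ um] := @Order.TotalTheory.arg_maxP _ _ _ i predT x isT.
have xu : 0 < x u by apply: lt_le_trans xi (um i isT).
exists u; apply: (maximal_vertex_dominates (x := fun i => (x u)^-1 * x i) k13 kn noG r0 rn).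
- by move=> j; apply: mulr_ge0 => //; rewrite invr_ge0 ltW.
- by move=> j; rewrite mulrC ler_pdivrMr // mul1r; apply: um.
- by rewrite mulVf // gt_eqF.
- by apply: scale_subinvariant xE; rewrite invr_ge0 ltW.
Qed.

(** * The case [k = 3] with maximum degree at most 3 off the dominating vertex *)

(** Here [X] is the entry at [u], [M] the largest other entry and [T] the degree-weighted sum off
    [u]. Eliminating [T] and [M] gives [A]; it passes from [r] down to [lam] because its left side
    grows faster than [12 * r]. *)
Lemma cubic_contradiction (R : realType) (lam r N T M X : R) :
  (lam ^+ 2 - N) * (lam ^+ 2 - lam - 4) = 4 * (3 * lam + 5) ->
  N <= lam ^+ 2 -> 100 <= lam -> lam <= r -> 0 <= M -> 0 < X ->
  r * M <= X + 3 * M -> r ^+ 2 * X <= N * X + T -> r * T <= 12 * X + 30 * M -> False.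
Proof.
move=> lamE lamN lam100 lr M0 X0 rM rX rT.
have A : (r - 3) * r * (r ^+ 2 - N) <= 12 * r - 6.
  rewrite -(ler_pM2r X0).
  have H1 : r * ((r ^+ 2 - N) * X) <= 12 * X + 30 * M.
    by apply: le_trans rT; apply: ler_wpM2l; [lra | rewrite mulrBl lerBlDl].
  have H2 : (r - 3) * (r * ((r ^+ 2 - N) * X)) <= (r - 3) * (12 * X + 30 * M).
    by apply: ler_wpM2l => //; lra.
  have -> : (r - 3) * r * (r ^+ 2 - N) * X = (r - 3) * (r * ((r ^+ 2 - N) * X)) by ring.
  by apply: le_trans H2 _; lra.
have B : (lam - 3) * lam * (lam ^+ 2 - N) <= (r - 3) * r * (lam ^+ 2 - N).
  by apply: ler_wpM2r; [lra | nra].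
have C : 12 * (r - lam) <= (r - 3) * r * (r ^+ 2 - lam ^+ 2).
  have -> : (r - 3) * r * (r ^+ 2 - lam ^+ 2) = ((r - 3) * r * (r + lam)) * (r - lam) by ring.
  apply: ler_wpM2r; first by lra.
  have : 97 <= r - 3 by lra.
  have : 97 * 100 <= (r - 3) * r by nra.
  by nra.
have D : (lam - 3) * lam * (lam ^+ 2 - N) <= 12 * lam - 6 by lra.
have q0 : 0 <= lam ^+ 2 - lam - 4 by nra.
(* The cubic terms cancel, which leaves [2 * lam ^+ 2 <= 18 * lam + 24]. *)
have E := ler_wpM2r q0 D; rewrite -[leLHS]mulrA lamE in E.
by nra.
Qed.

(* The last equation is [lam ^+ 2 = n - 1 + 12 / lam + 32 / lam ^+ 2 + ...] in closed
   form; walks of length 3 from [u] give 30 in place of 32 for [G]. *)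
Lemma hub_max_degree3_rho (R : realType) (n : nat) (G : sgraph n) u (lam : R) :
  (forall w, w != u -> adj G u w) -> ~ has_k_edge_disjoint_cycles G 3 ->
  (forall v, v \in [set~ u] -> #|nbr G v :&: [set~ u]| <= 3)%N ->
  (1 < n)%N -> 100 <= lam -> n%:R - 1 <= lam ^+ 2 ->
  (lam ^+ 2 - (n%:R - 1)) * (lam ^+ 2 - lam - 4) = 4 * (3 * lam + 5) ->
  rho R G < lam.
Proof.
move=> hub noG d3 n1 lam100 lamn lamE; rewrite ltNge; apply/negP => lr.
have n0 : (0 < n)%N by apply: ltnW.
set r := rho R G in lr *; pose S := [set~ u]; pose d v := #|nbr G v :&: S|.
have [s1 s2] : (\sum_(v in S) d v <= 12 /\ \sum_(v in S) d v ^ 2 <= 30)%N.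
  exact: max_degree3_bounds.
have [x [x0 xpos xE]] := rho_subinvariant R G n0.
have r0 : 0 < r by lra.
have split v : v \in S -> r * x v <= x u + \sum_(w in nbr G v :&: S) x w.
  rewrite !inE => vu; apply: le_trans (xE v) _; rewrite (bigD1 u) //= adj_sym hub // mul1r lerD2l.
  rewrite big_mkcond [leRHS]big_mkcond; apply: ler_sum => w _; rewrite !inE.
  by case: (w == u) => //=; rewrite ?andbT ?andbF //; case: (adj G v w); rewrite ?mul1r ?mul0r.
have [m mS xm] : exists2 m, m \in S & forall i, i \in S -> x i <= x m.
  have [w wS] : exists w, w \in S.
    by apply/set0Pn; rewrite -card_gt0 cardsC1 card_ord; lia.
  by case: (@Order.TotalTheory.arg_maxP _ _ _ w (fun i => i \in S) x wS) => m mu mm; exists m.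
have sumN v : v \in S -> \sum_(w in nbr G v :&: S) x w <= (d v)%:R * x m.
  move=> vS; rewrite mulr_natl -sumr_const; apply: ler_sum => w /setIP[_ wS].
  exact: xm.
have xm3 : r * x m <= x u + 3 * x m.
  apply: le_trans (split m mS) _; rewrite lerD2l; apply: le_trans (sumN m mS) _.
  by rewrite ler_wpM2r // (ler_nat R _ 3) d3.
have xu0 : 0 < x u.
  (* If [x u] were 0, then [(r - 3) * x m <= 0] would make the whole vector vanish. *)
  rewrite lt_neqAle x0 andbT eq_sym; apply/eqP => xu; move: xm3; rewrite xu add0r => xm3.
  have xm0 : x m <= 0 by nra.
  have [j] := xpos; have [->|ju] := eqVneq j u; first by rewrite xu ltxx.
  by rewrite ltNge (le_trans _ xm0) // xm // !inE.
have sumS : r * x u <= \sum_(v in S) x v.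
  apply: le_trans (xE u) _; rewrite (bigD1 u) //= adj_irr mul0r add0r.
  rewrite [leRHS](eq_bigl (fun v => v != u)) => [|v]; last by rewrite !inE.
  by apply: ler_sum => v _; rewrite ler_piMl // lern1; case: (adj G u v).
have cS : (\sum_(v in S) x u) = (n%:R - 1) * x u.
  by rewrite sumr_const cardsC1 card_ord -[(x u *+ _)]mulr_natl -subn1 natrB.
have step2 : r ^+ 2 * x u <= (n%:R - 1) * x u + \sum_(w in S) (d w)%:R * x w.
  rewrite expr2 -mulrA; apply: le_trans (ler_wpM2l (ltW r0) sumS) _.
  rewrite big_distrr /=; apply: le_trans (ler_sum _ split) _.
  rewrite big_split /= cS lerD2l.
  rewrite (eq_bigr (fun v => \sum_(w in S) (adj G v w)%:R * x w)) => [|v vS].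
    rewrite exchange_big /=; apply: ler_sum => w wS; rewrite -big_distrl /=.
    rewrite ler_wpM2r // /d card_nbrI natr_sum; apply: ler_sum => v _.
    by rewrite adj_sym.
  rewrite big_mkcond [RHS]big_mkcond; apply: eq_bigr => w _ /=; rewrite in_setI inE.
  by case: (w \in S); case: (adj G v w); rewrite ?mul1r ?mul0r.
have step3 : r * \sum_(w in S) (d w)%:R * x w <= 12 * x u + 30 * x m.
  rewrite big_distrr /=.
  apply: (@le_trans _ _ (\sum_(w in S) ((d w)%:R * x u + (d w ^ 2)%:R * x m))).
    apply: ler_sum => w wS; rewrite mulrCA natrX expr2 -mulrA -mulrDr.
    apply: ler_wpM2l => //; apply: le_trans (split w wS) _.
    by rewrite lerD2l sumN.
  rewrite big_split /= -!big_distrl /= -!natr_sum.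
  by apply: lerD; apply: ler_wpM2r => //; rewrite ?(ler_nat R _ 12) ?(ler_nat R _ 30).
exact: (cubic_contradiction lamE lamn lam100 lr (x0 m) xu0 xm3 step2 step3).
Qed.

(** * Large spectral radius forces an embedding; conclusion *)

Lemma large_rho_embeds (R : realType) (k n : nat) (G : sgraph n) (lam : R) :
  (1 <= k <= 3)%N -> (64 * k ^ 6 <= n)%N -> ~ has_k_edge_disjoint_cycles G k ->
  0 < lam -> n%:R - 1 <= lam ^+ 2 ->
  (k = 3 -> (lam ^+ 2 - (n%:R - 1)) * (lam ^+ 2 - lam - 4) = 4 * (3 * lam + 5)) ->
  lam <= rho R G ->
  (exists u, forall w, w != u -> adj G u w) /\ KH_embeds G k.
Proof.
move=> k13 kn noG lam0 lamn lamE lr.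
have r0 : 0 < rho R G by apply: lt_le_trans lr.
have rn : n%:R - 1 <= rho R G ^+ 2.
  by apply: le_trans lamn _; rewrite ler_sqr // nnegrE ltW.
have [u hub] := dominating_vertex k13 kn noG r0 rn; split; first by exists u.
have n64 : (64 <= n)%N.
  by apply: leq_trans kn; rewrite -{1}[64%N]muln1 leq_mul2l /= expn_gt0; case/andP: k13 => ->.
case: k k13 kn noG lamE => [|[|[|[|]]]] // _ kn noG lamE.
- by apply: hub_embeds1 hub _ noG; lia.
- by apply: hub_embeds2 hub _ noG; lia.
- have [/existsP[v /andP[vu v4]]|] :=
    boolP [exists v, (v != u) && (4 <= #|nbr G v :&: [set~ u]|)%N].
    exact: (hub_embeds3 hub noG vu v4).
  rewrite negb_exists => /forallP d3; move: lr; rewrite leNgt; case/negP.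
  apply: (hub_max_degree3_rho hub noG _ _ _ lamn (lamE erefl)).
  + move=> v; rewrite !inE => vu; have := d3 v; rewrite vu /=.
    by rewrite -ltnNge ltnS.
  + by apply: leq_trans n64.
  (* The bound [lam >= 100] follows from [lam ^+ 2 >= n - 1 >= 46655]. *)
  + have Hn : (64 * 3 ^ 6)%:R <= n%:R :> R by rewrite ler_nat.
    by move: Hn; rewrite natrM natrX => Hn; nra.
Qed.

Theorem theorem5p2 (R : realType) (k n : nat) :
  (1 <= k <= 3)%N -> (64 * k ^ 6 <= n)%N ->
  forall G : sgraph n, ~ has_k_edge_disjoint_cycles G k ->
    rho R G <= rho R (KH n k) /\ (rho R G = rho R (KH n k) <-> isomorphic G (KH n k)).
Proof.
move=> k13 kn G noG.
have n0 : (0 < n)%N by apply: leq_trans kn; rewrite muln_gt0 expn_gt0; case/andP: k13 => ->.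
have [lam [y [lam0 lamn y0 yE lamE]]] := KH_eigenvector R k13 kn.
have iso_rho H : isomorphic H (KH n k) -> rho R H = lam.
  exact: isomorphic_KH_rho n0 lam0 y0 yE.
have -> : rho R (KH n k) = lam by apply: iso_rho; exists 1%g => x z; rewrite !perm1.
have large : lam <= rho R G ->
    (exists u, forall w, w != u -> adj G u w) /\ KH_embeds G k.
  exact: large_rho_embeds k13 kn noG lam0 lamn lamE.
split.
  (* A graph whose spectral radius reaches [lam] embeds in [KH n k], and so cannot exceed it. *)
  case/orP: (le_total (rho R G) lam) => [//|/large[_ [f fG]]].
  exact: (embedded_rho_le n0 y0 yE fG).
split=> [E|/iso_rho//].
have lr : lam <= rho R G by rewrite E.
have [[u hub] [f fG]] := large lr.
exact: (embedded_rho_eq n0 y0 yE fG hub lam0 lr).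
Qed.
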